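(* Let $k\ge 2$ be an integer and let $G$ be a connected graph of order $n\ge 2k$. Then the following statements hold. (i) If $n=2k$ and $\rho_D(G)\le\rho_D(K_n-e)$, where $e\in E(K_n)$, then $\tau(G)\ge k$, unless $G\cong K_n-e$. (ii) If $n=2k+1$ and $\rho_D(G)\le\rho_D\bigl(\overline{P_3\cup(k-1)P_2}\bigr)$, then $\tau(G)\ge k$, unless $G\cong\overline{P_3\cup(k-1)P_2}$. (iii) If $n\ge 2k+2$ and $\rho_D(G)\le\rho_D\bigl(K_{k-1}\vee(K_{n-k}\cup K_1)\bigr)$, then $\tau(G)\ge k$, unless $G\cong K_{k-1}\vee(K_{n-k}\cup K_1)$.
   Context: All graphs are finite, undirected and simple. The order of a graph is its number of vertices. $\tau(G)$ is the maximum number of pairwise edge-disjoint spanning trees contained in $G$. For a connected graph $G$ with vertices $v_1,\dots,v_n$, the distance matrix $D(G)$ is the $n\times n$ matrix whose $(i,j)$ entry is the distance $d_G(v_i,v_j)$ (length of a shortest path), and $\rho_D(G)$, the distance spectral radius, is its largest eigenvalue. $K_m$ and $P_m$ denote the complete graph and the path on $m$ vertices; $K_n-e$ is $K_n$ with one edge deleted; $\overline{G}$ is the complement of $G$; $G_1\cup G_2$ is the disjoint union; $cG$ is the disjoint union of $c$ copies of $G$; $G_1\vee G_2$ is the join, obtained from the disjoint union $G_1\cup G_2$ by adding all edges between $V(G_1)$ and $V(G_2)$. *)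

(* Defs.v *)
From HB Require Import structures.
From mathcomp Require Import all_boot all_order all_algebra.
From mathcomp Require Import boolp classical_sets reals.

Set Implicit Arguments.
Unset Strict Implicit.
Unset Printing Implicit Defensive.

Import Order.TTheory GRing.Theory Num.Theory.

Record sgraph := SGraph {
  vertex :> finType;
  adj : rel vertex;
  adj_sym : symmetric adj;
  adj_irrefl : irreflexive adj }.

Arguments adj {s} x y : rename.

Definition giso (G H : sgraph) : Prop :=
  exists2 f : G -> H, bijective f & forall x y, adj (f x) (f y) = adj x y.

Definition edges (G : sgraph) : {set {set G}} :=
  [set [set x.1; x.2] | x : G * G & adj x.1 x.2]%SET.

Definition gconnected (G : sgraph) : Prop :=
  0 < #|G| /\ forall x y : G, connect adj x y.

(* A graph is simple, so its cycles are the [ucycle]s on at least 3 vertices. *)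
Definition acyclic (G : sgraph) : Prop :=
  forall c : seq G, ucycle adj c -> size c < 3.

Definition tree (G : sgraph) : Prop := gconnected G /\ acyclic G.

Section EdgeSet.
Variables (T : finType) (F : {set {set T}}).
Let a : rel T := fun x y => (x != y) && ([set x; y]%SET \in F).
Fact edge_graph_sym : symmetric a.
Proof. by move=> x y; rewrite /a eq_sym finset.setUC. Qed.
Fact edge_graph_irrefl : irreflexive a.
Proof. by move=> x; rewrite /a eqxx. Qed.
Definition edge_graph : sgraph := SGraph edge_graph_sym edge_graph_irrefl.
End EdgeSet.

Definition del_edge (G : sgraph) (e : {set G}) : sgraph :=
  edge_graph (edges G :\ e).

Section Complement.
Variable G : sgraph.
Let a : rel G := fun x y => (x != y) && ~~ adj x y.
Fact compl_sym : symmetric a.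
Proof. by move=> x y; rewrite /a eq_sym adj_sym. Qed.
Fact compl_irrefl : irreflexive a.
Proof. by move=> x; rewrite /a eqxx. Qed.
Definition gcompl : sgraph := SGraph compl_sym compl_irrefl.
End Complement.

Section UnionJoin.
Variables (b : bool) (G H : sgraph).
Let a : rel (G + H) := fun x y =>
  match x, y with
  | inl u, inl v => adj u v
  | inr u, inr v => adj u v
  | _, _ => b
  end.
Fact sum_sym : symmetric a.
Proof. by move=> [x|x] [y|y]; rewrite /a //= adj_sym. Qed.
Fact sum_irrefl : irreflexive a.
Proof. by move=> [x|x]; rewrite /a /= adj_irrefl. Qed.
(* [b] tells whether the two parts are completely joined or not at all. *)
Definition gsum : sgraph := SGraph sum_sym sum_irrefl.
End UnionJoin.

Definition gunion := gsum false.
Definition gjoin := gsum true.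

Section Copies.
Variables (c : nat) (G : sgraph).
Let a : rel ('I_c * G) := fun x y => (x.1 == y.1) && adj x.2 y.2.
Fact copies_sym : symmetric a.
Proof. by move=> x y; rewrite /a eq_sym adj_sym. Qed.
Fact copies_irrefl : irreflexive a.
Proof. by move=> x; rewrite /a adj_irrefl andbF. Qed.
Definition copies : sgraph := SGraph copies_sym copies_irrefl.
End Copies.

Section CompletePath.
Variable m : nat.
Let ka : rel 'I_m := fun x y => x != y.
Fact complete_sym : symmetric ka.
Proof. by move=> x y; rewrite /ka eq_sym. Qed.
Fact complete_irrefl : irreflexive ka.
Proof. by move=> x; rewrite /ka eqxx. Qed.
Definition complete_graph : sgraph := SGraph complete_sym complete_irrefl.

Let pa : rel 'I_m := fun x y => (x.+1 == y :> nat) || (y.+1 == x :> nat).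
Fact path_sym : symmetric pa.
Proof. by move=> x y; rewrite /pa orbC. Qed.
Fact path_irrefl : irreflexive pa.
Proof. by move=> x; rewrite /pa orbb gtn_eqF. Qed.
Definition path_graph : sgraph := SGraph path_sym path_irrefl.
End CompletePath.

Definition spanning_tree (G : sgraph) (F : {set {set G}}) : Prop :=
  F \subset edges G /\ tree (edge_graph F).

Definition tau (G : sgraph) : nat :=
  \max_(P : {set {set {set G}}} |
        finset.trivIset P && `[< forall F, F \in P -> spanning_tree F >]) #|P|.

(* A path has fewer than #|G| edges; the junk value for vertices in different
   components is #|G|. *)
Definition dist (G : sgraph) (x y : G) : nat :=
  find (fun l => [exists p : l.-tuple G,
                    [&& path adj x p, uniq (x :: p) & last x p == y]])
       (iota 0 #|G|).

Definition dist_mx (R : realType) (G : sgraph) : 'M[R]_#|G| :=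
  \matrix_(i, j) (dist (enum_val i) (enum_val j))%:R%R.

(* The spectrum of a real symmetric matrix of positive size is finite and
   nonempty, so this supremum is a maximum. *)
Definition rhoD (R : realType) (G : sgraph) : R :=
  sup [set x : R | eigenvalue (dist_mx R G) x]%classic.

(* Main.v *)
Require Import Defs.
From mathcomp Require Import all_boot all_order all_algebra reals.
From mathcomp Require Import perm spectral sesquilinear complex boolp.
From mathcomp Require Import zify ring lra.

Set Implicit Arguments.
Unset Strict Implicit.
Unset Printing Implicit Defensive.

Import Order.TTheory GRing.Theory Num.Theory.

(** Write [m] for the number of edges missing in [G], so that the Rayleigh
    quotient at the all-ones vector gives [rho_D(G) >= n - 1 + 2m/n].

    By the Nash-Williams--Tutte theorem, [tau(G) < k] yields an edge set [S]
    with [t + 1] components such that fewer than [k t] edges of [G] lie outside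
    [S]; as [S] has at most [C(n-t, 2)] edges, [m > t(n-k) - t(t+1)/2].  This is
    concave in [t], so its least values are at the ends of the range of [t].

    - If [n = 2k], then [G] is not complete, so it is a spanning subgraph of
      [K_n - e], and [rho_D] strictly decreases when edges are added.
    - If [n = 2k+1], then [m >= k+1].  The case [m >= k+2] is settled by the
      Rayleigh quotient.  If [m = k+1], either all complement degrees are
      positive, which forces the complement to be a path [P_3] and a matching,
      or the complement degrees are spread out enough for the bound
      [rho_D(G)^2 >= |D 1|^2 / n].
    - If [n >= 2k+2], either some vertex has degree less than [k] and [G] is a
      spanning subgraph of the extremal graph, or [m >= 2(n-k) - 2] and the
      Rayleigh quotient is large enough.

    Upper bounds on the radii of the extremal graphs come from explicit positive
    vectors [x] with [D x <= c x].

    The tree packing theorem is proved by exchanges (cf. Diestel): start from [k]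
    disjoint forests covering as many edges as possible, and let [U] be the set
    of edges left uncovered by some packing reachable by single-edge exchanges.
    Every forest then spans the components of [U], and counting edges inside and
    outside [U] shows that the forests are spanning trees. *)

(** * Perron eigenvectors *)

Section Rayleigh.
Local Open Scope ring_scope.
Local Open Scope sesquilinear_scope.

(** Viewed as a complex Hermitian matrix, [A] is unitarily diagonalizable with real eigenvalues; in
    an eigenbasis its quadratic form is a weighted sum of squared moduli, bounded through the
    largest weight. *)
Lemma sym_top_eigenvalue (R : rcfType) n (A : 'M[R]_n) : (0 < n)%N ->
  A^T = A -> exists2 l, eigenvalue A l &
    forall x : 'rV_n, (x *m A *m x^T) 0 0 <= l * (x *m x^T) 0 0.
Proof.
move=> n_gt0 Asym; pose f := real_complex R; pose B := map_mx f A.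
have fconj m p (M : 'M[R]_(m, p)) : (map_mx f M)^t* = map_mx f M^T.
  apply/matrixP=> i j; rewrite !mxE.
  by apply/CrealP/complex_realP; exists (M j i).
have Bherm : B \is hermsymmx.
  apply: realsym_hermsym.
    by apply/is_hermitianmxP; rewrite expr0 scale1r; apply/matrixP=> i j; rewrite !mxE -[in LHS]Asym mxE.
  by apply/mxOverP=> i j; rewrite mxE; apply/complex_realP; exists (A i j).
have /orthomx_spectralP := hermitian_normalmx Bherm.
have := hermitian_spectral_diag_real Bherm.
have := spectral_unitarymx B; have := spectral_unit B.
move: (spectralmx B) (spectral_diag B) => P d Punit Puni /mxOverP dreal defB.
have PP : P^t* *m P = 1%:M by rewrite -(invmx_unitary Puni) mulVmx.
have fM a b : f (a * b) = f a * f b by exact: rmorphM.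
have fsum F : f (\sum_j F j) = \sum_(j < n) f (F j) by exact: rmorph_sum.
have fRe z : z \is Num.real -> f (complex.Re z) = z by exact: RRe_real.
have [i _ maxi] := arg_maxP (fun i => complex.Re (d 0 i)) (erefl true : xpredT (Ordinal n_gt0)).
exists (complex.Re (d 0 i)).
  (* The eigenvalue is real, so being a root of the characteristic polynomial descends from [B] to
     [A]. *)
  rewrite eigenvalue_root_char -(fmorph_root f) map_char_poly -eigenvalue_root_char.
  rewrite [X in eigenvalue _ X](fRe _ (dreal _ _)); apply/eigenvalueP; exists (row i P).
    rewrite -row_mul -/B defB !mulmxA mulmxV // mul1mx.
    by rewrite row_mul row_diag_mx -scalemxAl -rowE.
  apply/eqP=> Pi0; have /(congr1 (row i)) := unitarymxP Puni.
  rewrite row_mul Pi0 mul0mx => /rowP /(_ i).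
  by rewrite !mxE eqxx => /esym/eqP; rewrite oner_eq0.
(* [y] holds the coordinates of [x] in the orthonormal eigenbasis. *)
move=> x; pose y := map_mx f x *m P^t*.
have yC : y^t* = P *m map_mx f x^T.
  by rewrite /y trmx_mul map_mxM /= fconj -map_trmx -map_mx_comp map_mx_id ?trmxK // => z; exact: conjCK.
have -> : (x *m A *m x^T) 0 0 = \sum_j complex.Re (d 0 j) * complex.Re (y 0 j * (y 0 j)^*).
  apply: (@complexI R); rewrite -/f.
  have -> : f ((x *m A *m x^T) 0 0) = (map_mx f (x *m A *m x^T)) 0 0 by rewrite [RHS]mxE.

  rewrite !map_mxM -/B defB invmx_unitary // !mulmxA -mulmxA -/y -yC.
  rewrite mxE fsum; apply: eq_bigr => j _.
  rewrite fM !fRe ?dreal //; last by rewrite -normCK rpredX // normr_real.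
  by rewrite mul_mx_diag !mxE mulrAC mulrC.

have -> : (x *m x^T) 0 0 = \sum_j complex.Re (y 0 j * (y 0 j)^*).
  apply: (@complexI R); rewrite -/f.
  have -> : f ((x *m x^T) 0 0) = (map_mx f (x *m x^T)) 0 0 by rewrite [RHS]mxE.
  have -> : map_mx f (x *m x^T) = y *m y^t*.
    by rewrite yC mulmxA -[y *m P]mulmxA PP mulmx1 map_mxM.
  rewrite mxE fsum; apply: eq_bigr => j _.
  by rewrite fRe ?mxE // -normCK rpredX // normr_real.
rewrite mulr_sumr; apply: ler_sum => j _; apply: ler_wpM2r; last exact: maxi.
by have := mul_conjC_ge0 (y 0 j); rewrite lecE => /andP[].
Qed.
End Rayleigh.

Section Perron.
Local Open Scope ring_scope.

Lemma mulmx_tr_le0 (R : realDomainType) n (x : 'rV[R]_n) : 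
  ((x *m x^T) 0 0 <= 0) = (x == 0).
Proof.
have -> : (x *m x^T) 0 0 = \sum_i x 0 i ^+ 2.
  by rewrite mxE; apply: eq_bigr => i _; rewrite mxE expr2.
apply/idP/eqP => [x2|->]; last by rewrite big1 // => i _; rewrite mxE expr0n.
apply/rowP => i; rewrite mxE; apply/eqP; rewrite -sqrf_eq0 eq_le sqr_ge0 andbT.
by apply: le_trans x2; rewrite (bigD1 i) //= lerDl sumr_ge0 // => j _; exact: sqr_ge0.
Qed.

(** Taking absolute values in a top eigenvector does not lower its Rayleigh quotient, so the result
    [w] is again a maximizer and hence an eigenvector. A zero entry of [w] would make a sum of
    nonnegative terms vanish and force [w = 0]. *)
Lemma perron (R : rcfType) n (A : 'M[R]_n) : (1 < n)%N -> A^T = A ->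
    (forall i j, 0 <= A i j) -> (forall i j, i != j -> 0 < A i j) ->
  exists l (y : 'rV_n), (forall i, 0 < y 0 i) /\ y *m A = l *: y.
Proof.
move=> n_gt1 Asym A_ge0 A_gt0; have n_gt0 : (0 < n)%N by exact: ltnW.
have [l /eigenvalueP[v vA v_neq0] ray] := sym_top_eigenvalue n_gt0 Asym.
pose w : 'rV_n := map_mx Num.norm v; exists l, w.
have ww : (w *m w^T) 0 0 = (v *m v^T) 0 0.
  by rewrite !mxE; apply: eq_bigr => i _; rewrite !mxE -!expr2 real_normK ?num_real.
have wAw : l * (w *m w^T) 0 0 <= (w *m A *m w^T) 0 0.
  have -> : l * (w *m w^T) 0 0 = (v *m A *m v^T) 0 0.
    by rewrite ww vA -scalemxAl [RHS]mxE.
  rewrite !mxE; apply: ler_sum => j _; rewrite !mxE.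
  apply: le_trans (ler_norm _) _; rewrite normrM ler_wpM2r //.
  apply: le_trans (ler_norm_sum _ _ _) _; apply: ler_sum => i _.
  by rewrite mxE normrM (ger0_norm (A_ge0 _ _)).
pose r := l *: w - w *m A.
have Asw (x y : 'rV[R]_n) : (x *m A *m y^T) 0 0 = (y *m A *m x^T) 0 0.
  have -> : x *m A *m y^T = (y *m A *m x^T)^T by rewrite !trmx_mul trmxK Asym mulmxA.
  by rewrite [LHS]mxE.
have sw (x y : 'rV[R]_n) : (x *m y^T) 0 0 = (y *m x^T) 0 0.
  have -> : x *m y^T = (y *m x^T)^T by rewrite !trmx_mul trmxK.
  by rewrite [LHS]mxE.
have dE (X Y : 'M[R]_1) : (X - Y) 0 0 = X 0 0 - Y 0 0 by rewrite !mxE.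
have zE c (X : 'M[R]_1) : (c *: X) 0 0 = c * X 0 0 by rewrite mxE.
have rE : (r *m r^T) 0 0 = l * (w *m r^T) 0 0 - (w *m A *m r^T) 0 0.
  by rewrite {1}/r mulmxBl dE -scalemxAl zE.
(* First variation of the nonnegative form [l x^2 - xAx] at its zero [w]. *)
have r0 : r = 0.
  clearbody r w; apply/eqP; rewrite -mulmx_tr_le0 leNgt; apply/negP => r_gt0.
  have var e : 0 <= l * (w *m w^T) 0 0 - (w *m A *m w^T) 0 0
      - 2 * e * (r *m r^T) 0 0 + e ^+ 2 * (l * (r *m r^T) 0 0 - (r *m A *m r^T) 0 0).
    have := ray (w - e *: r); rewrite -subr_ge0; congr (_ <= _).
    rewrite [(w - _)^T]raddfB /= [(_ *: r)^T]linearZ /= !(mulmxBl, mulmxBr).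
    rewrite -!(scalemxAl, scalemxAr) !(dE, zE) (Asw r w) (sw r w).
    move: rE; move: ((r *m r^T) 0 0) ((w *m A *m r^T) 0 0) ((w *m r^T) 0 0) => a b c ->.
    ring.
  set a := (r *m r^T) 0 0 in var r_gt0; set q := (l * a - _) in var.
  have q_gt0 : 0 < 1 + `|q| by rewrite ltr_pwDl.
  (* For this step length [e ^+ 2 * q] is at most [e * a], half of the linear term [2 * e * a], so
     the form would become negative. *)
  have := var (a / (1 + `|q|)); set e := a / _.
  have e_gt0 : 0 < e by rewrite divr_gt0.
  have ea : e * (1 + `|q|) = a by rewrite divfK // gt_eqF.
  have qq : q <= `|q| := ler_norm q.
  move: wAw; nra.
have wA : w *m A = l *: w by apply/eqP; rewrite eq_sym -subr_eq0 -/r r0.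
split=> // i; rewrite mxE normr_gt0; apply: contra v_neq0 => /eqP vi0.
have wi0 : w 0 i = 0 by rewrite mxE vi0 normr0.
have /rowP /(_ i) := wA; rewrite [RHS]mxE wi0 mulr0 mxE => s0.
apply/eqP/rowP => j; rewrite [RHS]mxE; have [->//|ji] := eqVneq j i.
have /psumr_eq0P /(_ s0 j isT) /eqP : forall j, true -> 0 <= w 0 j * A j i.
  by move=> m _; rewrite mulr_ge0 // mxE.
by rewrite mulf_eq0 (gt_eqF (A_gt0 _ _ ji)) orbF mxE normr_eq0 => /eqP.
Qed.
End Perron.

(** * Distances and the distance spectral radius *)

Section Distance.
Implicit Types G H : sgraph.

(** Propositional form of the search test in [dist], so that a witnessing path can be transformed
    directly. *)
Definition joined G (l : nat) (x y : G) := exists p : seq G,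
  [/\ size p = l, path adj x p, uniq (x :: p) & last x p = y].

Lemma joinedP G l (x y : G) : reflect (joined l x y)
  [exists p : l.-tuple G, [&& path adj x p, uniq (x :: p) & last x p == y]].
Proof.
apply: (iffP existsP) => [[p /and3P[xp up /eqP lp]]|[p [sp xp up lp]]].
  by exists p; rewrite size_tuple.
by exists (tcast sp (in_tuple p)); rewrite val_tcast /= xp lp eqxx andbT /= in up *.
Qed.

Lemma joined_size G l (x y : G) : joined l x y -> l < #|G|.
Proof. by case=> p [<- _ up _]; have := max_card (mem (x :: p)); rewrite (card_uniqP up). Qed.

Lemma dist_le G l (x y : G) : joined l x y -> dist x y <= l.
Proof.
move=> jl; rewrite leqNgt; apply/negP => /(before_find 0).
by rewrite nth_iota ?(joined_size jl) // add0n => /joinedP.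
Qed.

Lemma dist_leq_card G (x y : G) : dist x y <= #|G|.
Proof. by rewrite -[#|G|](size_iota 0) find_size. Qed.

(** The strict bound excludes the default value [#|G|], so the search in [dist] has succeeded. *)
Lemma dist_joined G (x y : G) : dist x y < #|G| -> joined (dist x y) x y.
Proof.
move=> lt; have /(nth_find 0) : has (fun l => [exists p : l.-tuple G,
    [&& path adj x p, uniq (x :: p) & last x p == y]]) (iota 0 #|G|).
  by rewrite has_find size_iota.
by rewrite nth_iota // => /joinedP.
Qed.

Lemma joined_sym G l (x y : G) : joined l x y -> joined l y x.
Proof.
case=> p [sp xp up lp]; exists (rev (belast x p)).
have E : y :: rev (belast x p) = rev (x :: p) by rewrite [in RHS]lastI rev_rcons lp.
rewrite size_rev size_belast E rev_uniq; split=> //.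
  by rewrite -lp rev_path; apply: sub_path xp => u v /=; rewrite adj_sym.
by rewrite -(last_cons y) E; case: (p) => //= a q; rewrite rev_cons last_rcons.
Qed.

Lemma dist_sym G (x y : G) : dist x y = dist y x.
Proof.
by apply: eq_find => l; apply/joinedP/joinedP; exact: joined_sym.
Qed.

Lemma dist_eq0 G (x y : G) : (dist x y == 0) = (x == y).
Proof.
apply/eqP/eqP => [d0|<-]; last first.
  by apply/eqP; rewrite -leqn0; apply: dist_le; exists [::].
have G_gt0 : 0 < #|G| by apply/card_gt0P; exists x.
by have := @dist_joined G x y; rewrite d0 => /(_ G_gt0) [[|a p] [// _ _ _ /= ->]].
Qed.

Lemma dist_adj G (x y : G) : adj x y -> dist x y = 1.
Proof.
move=> xy; have neq : x != y by apply: contraTneq xy => ->; rewrite adj_irrefl.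
apply/eqP; rewrite eqn_leq lt0n dist_eq0 neq andbT; apply: dist_le.
by exists [:: y]; split=> //=; rewrite ?xy // inE neq.
Qed.

Lemma dist_ge2 G (x y : G) : x != y -> ~~ adj x y -> 2 <= dist x y.
Proof.
move=> neq nxy; rewrite ltn_neqAle lt0n dist_eq0 neq andbT.
apply/eqP => d1; have G_gt1 : 1 < #|G|.
  have := max_card (mem [:: x; y]).
  by rewrite (card_uniqP _) //= inE neq.
have := @dist_joined G x y; rewrite -d1 => /(_ G_gt1) [[|z [|? ?]] [//= _ + _ zy]].
by rewrite zy andbT (negPf nxy).
Qed.

Lemma dist_le2 G (x y z : G) : x != y -> adj x z -> adj z y -> dist x y <= 2.
Proof.
move=> neq xz zy; apply: dist_le; exists [:: z; y]; split=> //=; rewrite ?xz ?zy //.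
rewrite !inE negb_or neq !andbT; apply/andP; split.
  by apply: contraTneq xz => ->; rewrite adj_irrefl.
by apply: contraTneq zy => ->; rewrite adj_irrefl.
Qed.

(** By cardinality [h] is a bijection, and its inverse carries every path of [G] to a path of
    [H]. *)
Lemma dist_mono G H (h : H -> G) : injective h -> #|G| <= #|H| ->
  (forall x y, adj (h x) (h y) -> adj x y) ->
  forall x y, dist x y <= dist (h x) (h y).
Proof.
move=> hI GH hadj x y; have [g hK gK] := inj_card_bij hI GH.
have [ge|/dist_joined[p [sp xp up lp]]] := leqP #|G| (dist (h x) (h y)).
  apply: leq_trans (dist_leq_card _ _) _; apply: leq_trans ge.
  exact: leq_card hI.
apply: dist_le; exists (map g p); rewrite size_map; split=> //.
- rewrite -[x]hK path_map; apply: sub_path xp => u v /= uv; apply: hadj.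
  by rewrite !gK.
- by rewrite -{1}[x]hK -map_cons map_inj_uniq //; exact: (can_inj gK).
- by rewrite -{1}[x]hK last_map lp hK.
Qed.

(** * The distance spectral radius as a Perron eigenvalue *)

Section Radius.
Local Open Scope ring_scope.
Variable R : realType.

Lemma sum_enum_val G (F : G -> R) : \sum_v F v = \sum_(i < #|G|) F (enum_val i).
Proof.
by rewrite (reindex (@enum_val G predT)) //; exact/onW_bij/enum_val_bij.
Qed.

(** Collatz-Wielandt argument: the eigenvalue equation is read at a coordinate where the ratio of
    [|v|] to the weight [x] is largest. *)
Lemma eigenvalue_dist_le G (x : G -> R) (c : R) : (forall u, 0 < x u) ->
  (forall u, \sum_v (dist u v)%:R * x v <= c * x u) ->
  forall l, eigenvalue (dist_mx R G) l -> l <= c.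
Proof.
move=> x_gt0 Dx l /eigenvalueP[v vD v_neq0].
have /rV0Pn[i0 vi0] := v_neq0.
pose r i := `|v 0 i| / x (enum_val i).
have [i _ maxi] := arg_maxP r (erefl true : xpredT i0).
have vr j : `|v 0 j| <= r i * x (enum_val j) by rewrite -ler_pdivrMr //; exact: maxi.
have vi_gt0 : 0 < `|v 0 i|.
  have : 0 < r i by apply: lt_le_trans (maxi i0 isT); rewrite divr_gt0 ?normr_gt0.
  by rewrite /r pmulr_lgt0 ?invr_gt0.
have lv : l * v 0 i = \sum_j v 0 j * (dist (enum_val i) (enum_val j))%:R.
  have /rowP/(_ i) := vD; rewrite mxE [RHS]mxE => <-.
  by apply: eq_bigr => j _; rewrite mxE dist_sym.
rewrite -(ler_pM2r vi_gt0); apply: le_trans (_ : r i * (c * x (enum_val i)) <= _).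
  apply: le_trans (_ : `|l * v 0 i| <= _).
    by rewrite normrM ler_wpM2r // ler_norm.
  rewrite lv; apply: le_trans (ler_norm_sum _ _ _) _.
  apply: le_trans (ler_wpM2l _ (Dx _)); last by rewrite divr_ge0 // ltW.
  rewrite sum_enum_val mulr_sumr; apply: ler_sum => j _.
  by rewrite normrM normr_nat mulrCA mulrC ler_wpM2l.
by rewrite mulrCA /r divfK // gt_eqF.
Qed.

(** Used as weight in the Collatz-Wielandt bound, the Perron vector shows that its own eigenvalue
    dominates all others, so it equals the supremum defining [rhoD]. *)
Lemma rhoD_eigenvector G : (1 < #|G|)%N -> exists y : G -> R,
  (forall u, 0 < y u) /\ forall u, \sum_v (dist u v)%:R * y v = rhoD R G * y u.
Proof.
move=> G_gt1; have [||i j|l [w [w_gt0 wD]]] := perron (A := dist_mx R G) G_gt1.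
- by apply/matrixP=> i j; rewrite !mxE dist_sym.
- by move=> i j; rewrite mxE.
- by rewrite mxE ltr0n lt0n dist_eq0 (inj_eq enum_val_inj).
pose y u := w 0 (enum_rank u); exists y.
have Dy u : \sum_v (dist u v)%:R * y v = l * y u.
  have /rowP/(_ (enum_rank u)) := wD; rewrite mxE [RHS]mxE => <-.
  rewrite sum_enum_val; apply: eq_bigr => j _.
  by rewrite mxE enum_rankK dist_sym mulrC /y enum_valK.
have y_gt0 u : 0 < y u by exact: w_gt0.
have le_l k : eigenvalue (dist_mx R G) k -> k <= l.
  by apply: eigenvalue_dist_le y_gt0 _ _ => u; rewrite Dy.
have l_ev : eigenvalue (dist_mx R G) l.
  apply/eigenvalueP; exists w => //; apply/rV0Pn.
  by exists (Ordinal (ltnW G_gt1)); rewrite gt_eqF.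
split=> // u; rewrite Dy; congr (_ * _); apply/eqP; rewrite eq_le; apply/andP; split.
  by apply: ub_le_sup => //; exists l.
by apply: ge_sup => //; exists l.
Qed.

Section Bounds.
Variable G : sgraph.
Hypothesis G_gt1 : (1 < #|G|)%N.

(** Both sides are paired with the positive Perron vector; symmetry of the distances turns the left
    side into [rhoD R G] times the same pairing. *)
Lemma rhoD_le (x : G -> R) (c : R) : (forall u, 0 < x u) ->
  (forall u, \sum_v (dist u v)%:R * x v <= c * x u) -> rhoD R G <= c.
Proof.
move=> x_gt0 Dx; have [y [y_gt0 Dy]] := rhoD_eigenvector G_gt1.
have /card_gt0P[u0 _] : (0 < #|G|)%N by exact: ltnW.
pose S z := \sum_u z u * y u : R.
have S_gt0 : 0 < \sum_u x u * y u.
  rewrite (bigD1 u0) //= ltr_pwDl ?mulr_gt0 ?sumr_ge0 // => u _.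
  by rewrite mulr_ge0 ?ltW.
rewrite -(ler_pM2r S_gt0) !mulr_sumr.
apply: le_trans (_ : \sum_u (\sum_v (dist u v)%:R * x v) * y u <= _); last first.
  by apply: ler_sum => u _; rewrite mulrA ler_wpM2r // ltW.
under [leRHS]eq_bigr do rewrite mulr_suml.
rewrite exchange_big /=; apply: ler_sum => v _.
rewrite mulrCA -Dy mulr_sumr; apply: ler_sum => u _.
by rewrite dist_sym le_eqVlt; apply/orP; left; apply/eqP; ring.
Qed.

(* Schur test with the Perron vector as weight. *)
Lemma rhoD_bilinear (x z : G -> R) :
  2 * \sum_u \sum_v (dist u v)%:R * x u * z v
    <= rhoD R G * (\sum_u x u ^+ 2 + \sum_u z u ^+ 2).
Proof.
have [y [y_gt0 Dy]] := rhoD_eigenvector G_gt1.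
have yne u : y u != 0 by rewrite gt_eqF.
pose t (f : G -> R) u v := (dist u v)%:R * f u ^+ 2 * y v / y u.
have tE f : \sum_u \sum_v t f u v = rhoD R G * \sum_u f u ^+ 2.
  rewrite mulr_sumr; apply: eq_bigr => u _.
  transitivity ((\sum_v (dist u v)%:R * y v) * (f u ^+ 2 / y u)).
    by rewrite mulr_suml; apply: eq_bigr => v _; rewrite /t; ring.
  by rewrite Dy; field.
rewrite mulrDr -tE -(tE z) [X in _ <= _ + X]exchange_big /=.
rewrite mulr_sumr -big_split; apply: ler_sum => u _ /=.
rewrite mulr_sumr -big_split; apply: ler_sum => v _ /=.
rewrite /t (dist_sym v u) -subr_ge0.
have -> : (dist u v)%:R * x u ^+ 2 * y v / y u + (dist u v)%:R * z v ^+ 2 * y u / y v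
    - 2 * ((dist u v)%:R * x u * z v)
  = (dist u v)%:R * (x u * y v - z v * y u) ^+ 2 / (y u * y v) :> R.
  by field; rewrite !yne.
by apply: divr_ge0; [rewrite mulr_ge0 ?sqr_ge0 ?ler0n | rewrite mulr_ge0 ?ltW].
Qed.

Lemma rhoD_rayleigh (x : G -> R) :
  \sum_u \sum_v (dist u v)%:R * x u * x v <= rhoD R G * \sum_u x u ^+ 2.
Proof.
rewrite -(ler_pM2l (ltr0Sn R 1)) mulrCA [2%:R * \sum__ x _ ^+ 2]mulr_natl mulr2n.
exact: rhoD_bilinear.
Qed.

Lemma rhoD_gt0 : 0 < rhoD R G.
Proof.
have [y [y_gt0 Dy]] := rhoD_eigenvector G_gt1.
have /card_gt1P[u [v [_ _ uv]]] := G_gt1.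
rewrite -(pmulr_lgt0 _ (y_gt0 u)) -Dy (bigD1 v) //= ltr_pwDl ?mulr_gt0 //.
  by rewrite ltr0n lt0n dist_eq0.
by apply: sumr_ge0 => w _; rewrite mulr_ge0 // ltW.
Qed.

(** The operator norm bound comes from the bilinear inequality tested on [x] and on the image of [x]
    divided by [rhoD R G]. *)
Lemma rhoD_sqr (x : G -> R) :
  \sum_u (\sum_v (dist u v)%:R * x v) ^+ 2 <= rhoD R G ^+ 2 * \sum_u x u ^+ 2.
Proof.
have r_gt0 := rhoD_gt0; set r := rhoD R G in r_gt0 *.
pose z u := (\sum_v (dist u v)%:R * x v) / r.
have := rhoD_bilinear z x; rewrite -/r.
have -> : \sum_u \sum_v (dist u v)%:R * z u * x v = r * \sum_u z u ^+ 2.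
  rewrite mulr_sumr; apply: eq_bigr => u _.
  transitivity (z u * \sum_v (dist u v)%:R * x v).
    by rewrite mulr_sumr; apply: eq_bigr => v _; ring.
  by rewrite /z; field; rewrite gt_eqF.
have -> : \sum_u (\sum_v (dist u v)%:R * x v) ^+ 2 = r ^+ 2 * \sum_u z u ^+ 2.
  rewrite mulr_sumr; apply: eq_bigr => u _.
  by rewrite /z; field; rewrite gt_eqF.
rewrite ler_pM2l ?exprn_gt0 // mulrCA ler_pM2l //.
by rewrite mulr_natl mulr2n lerD2l.
Qed.
End Bounds.

(** The Perron vector of [H], carried over to [G], serves as a test vector in [G]. No distance
    decreases from [H] to [G], and the lack of an isomorphism gives an edge of [H] missing in [G],
    whose ends move from distance 1 to at least 2. *)
Lemma rhoD_lt G H (h : H -> G) : (1 < #|G|)%N -> injective h -> #|G| = #|H| ->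
  (forall x y, adj (h x) (h y) -> adj x y) -> ~ giso G H -> rhoD R H < rhoD R G.
Proof.
move=> G_gt1 hI GH hadj niso; have H_gt1 : (1 < #|H|)%N by rewrite -GH.
have [g hK gK] := inj_card_bij hI (eq_leq GH).
have [x [y [nxy xy]]] : exists x y, ~~ adj (h x) (h y) /\ adj x y.
  apply: contra_notP niso => nex; exists g; first by exists h.
  move=> u v; apply/idP/idP => [uv|]; last by move=> uv; apply: hadj; rewrite !gK.
  apply: contra_notT nex => nuv; exists (g u), (g v).
  by rewrite !gK.
have [y0 [y_gt0 Dy]] := rhoD_eigenvector H_gt1.
have n_gt0 : 0 < \sum_u y0 u ^+ 2.
  by rewrite (bigD1 x) //= ltr_pwDl ?exprn_gt0 ?sumr_ge0 // => u _; exact: sqr_ge0.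
rewrite -(ltr_pM2r n_gt0).
have h_bij : {on [pred _ | true], bijective h} by apply: onW_bij; exists g.
have := rhoD_rayleigh G_gt1 (y0 \o g).
rewrite (reindex h) //= [X in _ * X](reindex h) //=.
under [X in _ <= _ * X]eq_bigr do rewrite hK.
apply: lt_le_trans; rewrite mulr_sumr -subr_gt0 -sumrB.
pose F u v := ((dist (h u) (h v))%:R - (dist u v)%:R) * (y0 u * y0 v) : R.
have F_ge0 u v : 0 <= F u v.
  by apply: mulr_ge0; [rewrite subr_ge0 ler_nat dist_mono ?GH | rewrite mulr_ge0 ?ltW].
have FE u : \sum_v (dist (h u) v)%:R * y0 (g (h u)) * y0 (g v) - rhoD R H * y0 u ^+ 2
    = \sum_v F u v.
  rewrite (reindex h) //= expr2 mulrA -Dy mulr_suml -sumrB.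
  by apply: eq_bigr => v _; rewrite !hK /F; ring.
under eq_bigr do rewrite FE.
rewrite (bigD1 x) //= (bigD1 y) //= -addrA ltr_pwDl //; last first.
  by rewrite addr_ge0 ?sumr_ge0 // => u _; rewrite sumr_ge0.
rewrite mulr_gt0 ?mulr_gt0 // subr_gt0 ltr_nat dist_adj // dist_ge2 //.
by rewrite (inj_eq hI); apply: contraTneq xy => ->; rewrite adj_irrefl.
Qed.
End Radius.
End Distance.

(** * Forests as independent edge sets *)

Section Forests.
Variable T : finType.
Implicit Types (F E S A Q : {set {set T}}) (x y u v : T).
Local Open Scope set_scope.

Definition conn F : rel T := connect (@adj (edge_graph F)).

Lemma connxx F x : conn F x x.
Proof. exact: connect0. Qed.

Lemma connC F x y : conn F x y = conn F y x.
Proof. by apply: sym_connect_sym => {}x {}y; rewrite adj_sym. Qed.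

Lemma conn_trans F y x z : conn F x y -> conn F y z -> conn F x z.
Proof. exact: connect_trans. Qed.

Lemma conn_edge F x y : x != y -> [set x; y] \in F -> conn F x y.
Proof. by move=> xy exy; apply: connect1; rewrite /= xy. Qed.

Lemma conn_sub F F' : (forall x y, x != y -> [set x; y] \in F -> conn F' x y) ->
  forall x y, conn F x y -> conn F' x y.
Proof.
by move=> FF'; apply: connect_sub => x y /andP[]; apply: FF'.
Qed.

Lemma conn_subset F F' x y : F \subset F' -> conn F x y -> conn F' x y.
Proof.
move=> /subsetP sub; apply: conn_sub => u v uv /sub; exact: conn_edge.
Qed.

Lemma eq_set2 x y u v : [set x; y] = [set u; v] -> (x = u /\ y = v) \/ (x = v /\ y = u).
Proof.
move=> eq; have [] := (set21 x y, set22 x y); rewrite eq !inE.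
move=> /orP[] /eqP ex /orP[] /eqP ey; subst; auto.
  by have := set22 u v; rewrite -eq !inE orbb => /eqP ->; auto.
by have := set21 u v; rewrite -eq !inE orbb => /eqP ->; auto.
Qed.

Lemma conn_add F u v x y : u != v ->
  conn ([set u; v] |: F) x y =
  [|| conn F x y, conn F x u && conn F v y | conn F x v && conn F u y].
Proof.
move=> uv; have sub : F \subset [set u; v] |: F by exact: subsetUr.
have cuv : conn ([set u; v] |: F) u v by rewrite conn_edge // setU11.
have lift := conn_subset sub.
apply/idP/idP => [/connectP[p]|]; last first.
  move=> /or3P[/lift//|/andP[/lift xu /lift vy]|/andP[/lift xv /lift uy]].
    exact: conn_trans xu (conn_trans cuv vy).
  by apply: conn_trans xv (conn_trans _ uy); rewrite connC.
elim/last_ind: p y => [|p z IHp] y /=; first by move=> _ ->; rewrite connxx.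
rewrite rcons_path last_rcons => /andP[/IHp/(_ erefl) IH /= /andP[wz]] + ->.
move: (last x p) wz IH => w wz IH /setU1P[/eq_set2[][? ?]|Fwz]; subst.
- have c0 := connxx F.
  by case/or3P: IH => [->|/andP[->]|/andP[->]]; rewrite ?c0 ?orbT.
- have c0 := connxx F.
  by case/or3P: IH => [->|/andP[->]|/andP[->]]; rewrite ?c0 ?orbT.
have c := conn_edge wz Fwz.
by case/or3P: IH => [d|/andP[-> d]|/andP[-> d]]; rewrite (conn_trans d c) ?orbT.
Qed.

(** Excludes members that are not two-element sets: they would count in [#|F|] without affecting
    connectivity. *)
Definition pairs F := forall e, e \in F -> exists x y, x != y /\ e = [set x; y].

(** Independence in the graphic matroid, stated as every edge being a bridge. *)
Definition indep F :=
  forall x y, x != y -> [set x; y] \in F -> ~~ conn (F :\ [set x; y]) x y.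

Lemma pairs_sub F F' : F \subset F' -> pairs F' -> pairs F.
Proof. by move=> /subsetP sub pF e /sub /pF. Qed.

Lemma indep_sub F F' : F \subset F' -> indep F' -> indep F.
Proof.
move=> sub iF x y xy /(subsetP sub)/(iF _ _ xy); apply: contra.
exact/conn_subset/setSD.
Qed.

Lemma indep_add F x y : x != y -> indep F -> ~~ conn F x y ->
  indep ([set x; y] |: F).
Proof.
move=> xy iF nxy a b ab; have [eq|neq] := eqVneq [set a; b] [set x; y].
  move=> _; rewrite eq; have sub : ([set x; y] |: F) :\ [set x; y] \subset F.
    by apply/subsetP => e; rewrite !inE => /andP[/negPf ->].
  apply: contra nxy => /(conn_subset sub).
  by case: (eq_set2 eq) => -[-> ->] //; rewrite connC.
rewrite !inE (negPf neq) /= => Fab.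
have -> : ([set x; y] |: F) :\ [set a; b] = [set x; y] |: (F :\ [set a; b]).
  apply/setP => e; rewrite !inE; have [->|//] := eqVneq e [set x; y].
  by rewrite eq_sym neq.
rewrite conn_add //; have := iF _ _ ab Fab; apply: contraNN => /or3P[//| |].
  move=> /andP[ax yb]; case/negP: nxy; have sub := subD1set F [set a; b].
  apply: (@conn_trans _ a); first by rewrite connC (conn_subset sub).
  apply: (@conn_trans _ b); first exact: conn_edge.
  by rewrite connC (conn_subset sub).
move=> /andP[ay xb]; case/negP: nxy; have sub := subD1set F [set a; b].
apply: (@conn_trans _ b); first by rewrite (conn_subset sub).
rewrite connC; apply: (@conn_trans _ a); last exact: conn_edge.
by rewrite connC (conn_subset sub).
Qed.

(* The hypothesis on [A] says that it contains the fundamental path of [xy]. *)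
Lemma indep_conn_sub F A x y : pairs F -> indep F -> A \subset F -> conn F x y ->
  (forall e, e \in F -> ~~ conn (F :\ e) x y -> e \in A) -> conn A x y.
Proof.
move=> pF iF AF cF path_A.
(* The edges of [F] outside [A] are deleted one at a time, keeping [x] and [y] joined. *)
suff H m Q : #|Q :\: A| = m -> A \subset Q -> Q \subset F -> conn Q x y -> conn A x y.
  exact: H erefl AF (subxx _) cF.
elim: m Q => [|m IHm] Q; first by move/cards0_eq/eqP; rewrite setD_eq0 => sub _ _; exact: conn_subset.
move=> Qm AQ QF cQ; have /card_gt0P[e /setDP[Qe nAe]] : 0 < #|Q :\: A| by rewrite Qm.
have Fe := subsetP QF e Qe.
have [u [v [uv eE]]] := pF e Fe.
have AQe : A \subset Q :\ e by rewrite subsetD1 AQ.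
apply: (IHm (Q :\ e)) => //; first last.
(* As [e] is not in [A], deleting it from [F] leaves [x] and [y] joined. If [Q] needed [e] to join
   them, the ends of [e] would also be joined in [F] without [e], against independence. *)
- have : conn (F :\ e) x y by apply: contraNT nAe; exact: path_A.
  have := iF u v uv; rewrite -eE => /(_ Fe) nuv c.
  have QFe : Q :\ e \subset F :\ e by exact: setSD.
  have lift := conn_subset QFe.
  have : conn ([set u; v] |: Q :\ e) x y by rewrite -eE setD1K.
  rewrite conn_add //.
  case/or3P=> // /andP[/lift c1 /lift c2]; case/negP: nuv.
    rewrite connC in c1; apply: conn_trans c1 (conn_trans c _).
    by rewrite connC.
  by rewrite connC in c; apply: conn_trans c2 (conn_trans c c1).
- by apply: subset_trans QF; exact: subD1set.
- have := cardsD1 e (Q :\: A); rewrite Qm inE nAe Qe => -[->].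
  by rewrite setDDl (setUC [set e]) -setDDl.
Qed.

(** * Components and the rank formula *)

Definition comp F x := [set y | conn F x y].

Definition ncomp F := #|comp F @: [set: T]|.

Lemma eq_comp F x y : conn F x y -> comp F x = comp F y.
Proof.
move=> xy; apply/setP => z; rewrite !inE; apply/idP/idP; last exact: conn_trans.
by apply: conn_trans; rewrite connC.
Qed.

Lemma conn_eql F x y z : conn F x y -> conn F x z = conn F y z.
Proof. by move=> /eq_comp/setP/(_ z); rewrite !inE. Qed.

Lemma comp_id F x : x \in comp F x.
Proof. by rewrite inE connxx. Qed.

Lemma comp_eqP F x y : reflect (comp F x = comp F y) (conn F x y).
Proof.
apply: (iffP idP) => [|eq]; first exact: eq_comp.
by have := comp_id F y; rewrite -eq inE.
Qed.

(** The new edge replaces the two classes of [x] and [y] by their union [U] and leaves the other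
    classes alone. *)
Lemma ncomp_add F x y : x != y -> ~~ conn F x y ->
  ncomp F = (ncomp ([set x; y] |: F)).+1.
Proof.
move=> xy nxy; pose U := comp F x :|: comp F y.
have mem_cl (A : {set T}) z : A \in comp F @: setT -> z \in A -> A = comp F z.
  by case/imsetP => w _ ->; rewrite inE => /comp_eqP.
have cE z : comp ([set x; y] |: F) z = if z \in U then U else comp F z.
  apply/setP => w; rewrite !inE conn_add //; case: ifP => zU; last first.
    move/norP: (negbT zU) => [nxz nyz].
    rewrite (connC F z x) (connC F z y) (negPf nxz) (negPf nyz) /=.
    by rewrite !orbF inE.
  rewrite inE; case/orP: zU => c; rewrite -!(conn_eql _ c).
    by rewrite (negPf nxy) connxx orbF !inE.
  by rewrite (connC F y x) (negPf nxy) connxx orbC !inE.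
have -> : ncomp ([set x; y] |: F) = #|U |: (comp F @: setT :\ comp F x :\ comp F y)|.
  congr #|pred_of_set _|; apply/setP => A; apply/imsetP/setU1P => [[z _ ->]|].
    rewrite cE; case: ifP => zU; [by left|right].
    move: zU; rewrite inE => /norP[]; rewrite !inE => nxz nyz.
    rewrite !(eq_sym (comp F z)); apply/and3P; split; last exact: imset_f.
      by apply: contra nyz => /eqP/comp_eqP.
    by apply: contra nxz => /eqP/comp_eqP.
  case=> [->|]; first by exists x; rewrite ?cE ?inE // connxx.
  rewrite !inE => /and3P[nyA nxA /imsetP[z _ AE]]; subst A; exists z => //.
  rewrite cE ifN // !inE; apply/norP; split.
    by apply: contra nxA => /eq_comp ->.
  by apply: contra nyA => /eq_comp ->.
have nU : U \notin comp F @: setT.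
  apply/negP => UF; case/negP: nxy; apply/comp_eqP.
  have xU : x \in U by rewrite inE comp_id.
  have yU : y \in U by rewrite inE comp_id orbT.
  exact: etrans (esym (mem_cl _ _ UF xU)) (mem_cl _ _ UF yU).
rewrite cardsU1 !inE (negPf nU) !andbF /= add1n.
rewrite /ncomp (cardsD1 (comp F x)) imset_f // (cardsD1 (comp F y)) !inE imset_f //.
by rewrite andbT eq_sym; case: eqP => // /comp_eqP; rewrite (negPf nxy).
Qed.

Lemma ncomp0 : ncomp set0 = #|T|.
Proof.
rewrite /ncomp card_imset ?cardsT // => x y /comp_eqP /connectP[[|z p] /= xp -> //].
by move: xp; rewrite inE andbF.
Qed.

(** Every edge is a bridge, so deleting the edges one by one raises the number of components by one
    each time, up to [#|T|]. *)
Lemma card_indep F : pairs F -> indep F -> #|F| + ncomp F = #|T|.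
Proof.
elim: {F}_.+1 {-2}F (ltnSn #|F|) => // m IHm F; rewrite ltnS => Fm pF iF.
have [->|[e Fe]] := set_0Vmem F; first by rewrite cards0 ncomp0.
have [x [y [xy eE]]] := pF e Fe; have sub := subD1set F e.
have nxy : ~~ conn (F :\ e) x y by rewrite eE; apply: iF; rewrite -?eE.
have := IHm (F :\ e); rewrite (ncomp_add xy nxy) -eE setD1K // addnS -addSn.
have -> : #|F :\ e|.+1 = #|F| by rewrite (cardsD1 e F) Fe.
apply; last exact: indep_sub iF.
  by move: Fm; rewrite (cardsD1 e F) Fe.
exact: pairs_sub pF.
Qed.

Lemma ncomp_gt0 F : 0 < #|T| -> 0 < ncomp F.
Proof.
by case/card_gt0P => x _; apply/card_gt0P; exists (comp F x); exact: imset_f.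
Qed.

Lemma ncomp_le1 F x y : ncomp F <= 1 -> conn F x y.
Proof.
move/card_le1_eqP => eq; apply/comp_eqP; apply: eq; exact: imset_f.
Qed.

(** The rest of a cycle through the edge [xy] joins [y] to [x] without that edge, because it never
    returns to [y]. *)
Lemma indep_acyclic F : indep F -> acyclic (edge_graph F).
Proof.
move=> iF [|x [|y [|z p]]] // /andP[/= /and3P[/andP[xy Fxy] /andP[yz Fyz] zp]].
move=> /and4P[]; rewrite !inE !negb_or => /and3P[_ xz xp] /andP[_ yp] _ _.
case/negP: (iF x y xy Fxy); rewrite connC.
have yzD : conn (F :\ [set x; y]) y z.
  rewrite conn_edge // !inE Fyz andbT; apply/eqP => /eq_set2[][? ?]; subst.
    by rewrite eqxx in xy.
  by rewrite eqxx in xz.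
apply: conn_trans yzD _; apply/connectP; exists (rcons p x); last by rewrite last_rcons.
have Pz : all (predC1 y) (z :: rcons p x).
  rewrite /= eq_sym yz all_rcons /= xy; apply/allP => w wp /=.
  by apply: contraNneq yp => <-.
apply: sub_in_path Pz zp => u v; rewrite !inE => uy vy /= /andP[uv Fuv].
rewrite uv !inE Fuv andbT /=; apply/eqP => /eq_set2[][? ?]; subst.
  by rewrite eqxx in vy.
by rewrite eqxx in uy.
Qed.

Lemma indep_tree F : pairs F -> indep F -> 0 < #|T| -> #|T|.-1 <= #|F| ->
  tree (edge_graph F).
Proof.
move=> pF iF T_gt0 szF; split; last exact: indep_acyclic.
split=> // x y; apply: ncomp_le1.
by move: (card_indep pF iF) szF T_gt0; lia.
Qed.

End Forests.

(** * Packing spanning trees *)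

Section TreePacking.
Variables (T : finType) (k : nat) (E : {set {set T}}).
Hypothesis E_pairs : pairs E.
Local Open Scope set_scope.

(* An edge coloured [Some i] is assigned to the [i]-th forest. *)
Implicit Types (c d : {ffun {set T} -> option 'I_k}) (i j : 'I_k) (e f : {set T}).

Definition part c i := [set e in E | c e == Some i].
Definition covered c := [set e in E | c e != None].
Definition packing c := forall i, indep (part c i).

Lemma part_sub c i : part c i \subset E.
Proof. by apply/subsetP => e; rewrite inE => /andP[]. Qed.

Lemma part_pairs c i : pairs (part c i).
Proof. exact: pairs_sub (part_sub c i) E_pairs. Qed.

Definition recolour c e (o : option 'I_k) := [ffun f => if f == e then o else c f].

Lemma part_add c e i : e \in E -> part (recolour c e (Some i)) i = e |: part c i.
Proof.
move=> Ee; apply/setP => f; rewrite !inE ffunE.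
by case: (f =P e) => [->|//]; rewrite Ee eqxx.
Qed.

Lemma part_add_other c e i j : c e = None -> i != j ->
  part (recolour c e (Some i)) j = part c j.
Proof.
move=> ce ij; apply/setP => f; rewrite !inE ffunE; case: (f =P e) => [->|//].
by rewrite ce /= -[_ == _]/(i == j) (negPf ij).
Qed.

Lemma part_del c e j : part (recolour c e None) j = part c j :\ e.
Proof.
apply/setP => f; rewrite !inE ffunE; case: (f =P e) => [->|//] /=; exact: andbF.
Qed.

Lemma covered_add c e i : e \in E -> covered (recolour c e (Some i)) = e |: covered c.
Proof.
move=> Ee; apply/setP => f; rewrite !inE ffunE.
by case: (f =P e) => [->|//]; rewrite Ee.
Qed.

Lemma covered_del c e : covered (recolour c e None) = covered c :\ e.
Proof.
apply/setP => f; rewrite !inE ffunE; case: (f =P e) => [->|//] /=; exact: andbF.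
Qed.

Definition exchange c e f i := recolour (recolour c f None) e (Some i).

(** A step trades a covered edge for an uncovered one. The last premise keeps forest [i]
    independent; when [x] and [y] are joined in that forest, it says that [f] lies on the path
    between them. *)
Inductive reachable (c0 : {ffun {set T} -> option 'I_k}) : {ffun {set T} -> option 'I_k} -> Prop :=
| Reach0 : reachable c0 c0
| ReachS c x y f i : reachable c0 c -> x != y -> [set x; y] \in E ->
    c [set x; y] = None -> f \in part c i -> ~~ conn (part c i :\ f) x y ->
    reachable c0 (exchange c [set x; y] f i).

Section Exchange.
Variables (c : {ffun {set T} -> option 'I_k}) (x y : T) (f : {set T}) (i : 'I_k).
Hypotheses (xy : x != y) (Exy : [set x; y] \in E) (cxy : c [set x; y] = None).
Hypotheses (cf : f \in part c i) (nconn : ~~ conn (part c i :\ f) x y).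

Lemma part_exchange : part (exchange c [set x; y] f i) i = [set x; y] |: part c i :\ f.
Proof. by rewrite part_add // part_del. Qed.

Lemma part_exchange_other j : i != j -> part (exchange c [set x; y] f i) j = part c j.
Proof.
move=> ij; rewrite part_add_other // ?part_del; last by rewrite ffunE cxy if_same.
apply/setDidPl; rewrite disjoint_sym disjoints1 inE.
move: cf; rewrite inE => /andP[-> /eqP ->] /=.
by rewrite -[_ == _]/(i == j) (negPf ij).
Qed.

Lemma packing_exchange : packing c -> packing (exchange c [set x; y] f i).
Proof.
move=> pc j; have [<-|ij] := eqVneq i j; last by rewrite part_exchange_other.
rewrite part_exchange; apply: indep_add => //.
exact: indep_sub (subD1set _ _) (pc i).
Qed.

Lemma card_covered_exchange : #|covered (exchange c [set x; y] f i)| = #|covered c|.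
Proof.
move: cf; rewrite inE => /andP[Ef /eqP cfi].
rewrite covered_add // covered_del cardsU1 !inE cxy !andbF /= add1n.
by rewrite (cardsD1 f (covered c)) inE Ef cfi.
Qed.
End Exchange.

(** * Packings that cover as many edges as possible *)

Section Maximal.
Variable c0 : {ffun {set T} -> option 'I_k}.
Hypothesis c0_packing : packing c0.
Hypothesis c0_max : forall c, packing c -> #|covered c| <= #|covered c0|.

Lemma reachable_packing c : reachable c0 c -> packing c /\ #|covered c| = #|covered c0|.
Proof.
elim=> // {}c x y f i _ [pc <-] xy Exy cxy cf nc.
by split; [exact: packing_exchange | exact: card_covered_exchange].
Qed.

(** Otherwise the uncovered edge could be added to forest [i], against maximality of the cover. *)
Lemma uncovered_conn c x y i : reachable c0 c -> x != y -> [set x; y] \in E ->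
  c [set x; y] = None -> conn (part c i) x y.
Proof.
move=> /reachable_packing[pc cc] xy Exy cxy; apply/negPn/negP => nc.
have : packing (recolour c [set x; y] (Some i)).
  move=> j; have [<-|ij] := eqVneq i j; last by rewrite part_add_other.
  by rewrite part_add //; exact: indep_add.
by move/c0_max; rewrite covered_add // cardsU1 inE cxy andbF cc ltnn.
Qed.

(** The set [U] of the overview. *)
Definition unstable := [set e in E | `[< exists2 c, reachable c0 c & c e = None >]].

(** Each edge [f] on the path of forest [i] between [x] and [y] can be exchanged for [xy]; this
    uncovers [f], so the whole path is unstable. *)
Lemma uncovered_conn_unstable c x y i : reachable c0 c -> x != y ->
  [set x; y] \in E -> c [set x; y] = None -> conn (part c i :&: unstable) x y.
Proof.
move=> rc xy Exy cxy; have [pc _] := reachable_packing rc.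
apply: (indep_conn_sub (part_pairs (i := i)) (pc i)); first exact: subsetIl.
  exact: uncovered_conn.
move=> f cf nc; rewrite !inE; move: (cf); rewrite inE => /andP[Ef cfi].
rewrite Ef cfi /=; apply/asboolP; exists (exchange c [set x; y] f i).
  exact: ReachS.
rewrite !ffunE eqxx ifN //; apply: contraTneq cfi => ->.
by rewrite cxy.
Qed.

(** An exchange swaps two unstable edges of one cycle whose edges are all unstable, so the classes
    spanned by the unstable edges of each forest do not change. *)
Lemma reachable_conn c i a b : reachable c0 c ->
  conn (part c i :&: unstable) a b = conn (part c0 i :&: unstable) a b.
Proof.
move=> rc; elim: rc a b => // {}c x y f j rc IHc xy Exy cxy cf nc a b.
rewrite -{}IHc; have [<-|ji] := eqVneq j i; last by rewrite part_exchange_other.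
rewrite part_exchange //.
have Uxy : [set x; y] \in unstable.
  by rewrite inE Exy; apply/asboolP; exists c.
have cc := uncovered_conn_unstable j rc xy Exy cxy.
set A := part c j :&: unstable in cc *.
have -> : ([set x; y] |: part c j :\ f) :&: unstable = [set x; y] |: A :\ f.
  by rewrite setIUl (setIidPl _) ?sub1set // setIDAC.
have [u [v [uv fE]]] : exists u v, u != v /\ f = [set u; v] by exact: part_pairs cf.
have fA : f \in A.
  rewrite inE cf inE; move: (cf); rewrite inE => /andP[-> cfj]; apply/asboolP.
  exists (exchange c [set x; y] f j); first exact: ReachS.
  rewrite !ffunE eqxx ifN //; apply: contraTneq cfj => ->.
  by rewrite cxy.
have nA : ~~ conn (A :\ f) x y.
  by apply: contra nc; apply: conn_subset; apply: setSD; exact: subsetIl.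
apply/idP/idP; apply: conn_sub => p q pq.
  case/setU1P => [/eq_set2[][-> ->]|] //; first by rewrite connC.
  by move/(subsetP (subD1set _ _)); exact: conn_edge.
have [e|neq] := eqVneq [set p; q] f; last first.
  move=> pqA; apply: conn_edge => //; apply/setU1P; right.
  by apply/setD1P.
(* The removed edge [f] is rerouted: the remaining pieces of the path from [x] to [y], together with
   the new edge [xy], join the ends of [f]. *)
move=> _; move: cc; rewrite -{1}(setD1K fA) {1}fE conn_add // (negPf nA) /=.
have lift := conn_subset (subsetUr [set [set x; y]] (A :\ f)).
have cxy' : conn ([set x; y] |: A :\ f) x y by rewrite conn_edge // setU11.
case/orP=> /andP[/lift c1 /lift c2].
  have cuv : conn ([set x; y] |: A :\ f) u v.
    apply: conn_trans (conn_trans cxy' _); first by rewrite connC.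
    by rewrite connC.
  by case: (eq_set2 (etrans e fE)) => -[-> ->] //; rewrite connC.
have cuv : conn ([set x; y] |: A :\ f) u v.
  by apply: conn_trans c2 (conn_trans _ c1); rewrite connC.
by case: (eq_set2 (etrans e fE)) => -[-> ->] //; rewrite connC.
Qed.

(** An unstable edge is uncovered in some reachable packing, where unstable edges of forest [i] join
    its ends; this connectivity is the same as in [c0]. *)
Lemma ncomp_unstable i : ncomp (part c0 i :&: unstable) = ncomp unstable.
Proof.
congr #|pred_of_set _|; apply: eq_imset => a; apply/setP => b; rewrite !inE.
apply/idP/idP; first by apply: conn_subset; exact: subsetIr.
apply: conn_sub => x y xy; rewrite inE => /andP[Exy /asboolP[c rc cxy]].
by rewrite -(reachable_conn _ _ _ rc); exact: uncovered_conn_unstable.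
Qed.

Lemma card_part_unstable i : #|part c0 i :&: unstable| + ncomp unstable = #|T|.
Proof.
rewrite -(ncomp_unstable i) card_indep //.
  exact: pairs_sub (subsetIl _ _) (@part_pairs c0 i).
exact: indep_sub (subsetIl _ _) (@c0_packing i).
Qed.

Lemma card_covered c : #|covered c| = \sum_i #|part c i|.
Proof.
under eq_bigr do rewrite -sum1_card.
rewrite (exchange_big_dep (mem (covered c))) /=; last first.
  by move=> i e _; rewrite !inE => /andP[-> /eqP ->].
rewrite -sum1_card; apply: eq_bigr => e; rewrite inE => /andP[Ee].
case ce: (c e) => [i|] // _; rewrite (big_pred1 i) // => j.
by rewrite inE Ee ce eq_sym.
Qed.

(** As [c0] is reachable from itself, every edge outside [unstable] is covered by [c0]. *)
Lemma card_unstable_covered :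
  #|covered c0| = #|E :\: unstable| + \sum_i #|part c0 i :&: unstable|.
Proof.
rewrite card_covered; under eq_bigr do rewrite -(cardsID unstable).
rewrite big_split addnC /=; congr (_ + _).
have -> : E :\: unstable = covered c0 :\: unstable.
  apply/setP => e; rewrite !inE; case Ee: (e \in E) => /=; last by rewrite ?andbF.
  case: asboolP => //= nex; apply/esym/eqP => ce; case: nex.
  by exists c0 => //; exact: Reach0.
under eq_bigr do rewrite -sum1_card.
rewrite (exchange_big_dep (mem (covered c0 :\: unstable))) /=; last first.
  by move=> i e _; rewrite !inE => /and3P[-> -> /eqP ->].
rewrite -[RHS]sum1_card; apply: eq_bigr => e; rewrite inE => /andP[ne].
rewrite inE => /andP[Ee]; case ce: (c0 e) => [i|] // _.
by rewrite (big_pred1 i) // => j; rewrite inE ne inE Ee ce /= eq_sym.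
Qed.

(** Each forest has [#|T| - ncomp unstable] unstable edges; with the assumed edges outside
    [unstable], at least [k * #|T|.-1] edges are covered. No forest exceeds [#|T|.-1] edges, so each
    attains it. *)
Lemma maximal_spanning : 0 < #|T| ->
  k * (ncomp unstable - 1) <= #|E :\: unstable| ->
  forall i, tree (edge_graph (part c0 i)).
Proof.
move=> T_gt0 hE i; apply: indep_tree => //; first exact: part_pairs.
have szU j : #|part c0 j :&: unstable| = #|T| - ncomp unstable.
  by rewrite -(card_part_unstable j) addnK.
have szP j : #|part c0 j| <= #|T|.-1.
  have := card_indep (@part_pairs c0 j) (@c0_packing j).
  by have := ncomp_gt0 (part c0 j) T_gt0; lia.
have U_gt0 := ncomp_gt0 unstable T_gt0.
have U_le : ncomp unstable <= #|T| by rewrite -(card_part_unstable i) leq_addl.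
have : k * #|T|.-1 <= \sum_j #|part c0 j|.
  rewrite -card_covered card_unstable_covered; under eq_bigr do rewrite szU.
  rewrite sum_nat_const card_ord; apply: leq_trans (leq_add hE (leqnn _)).
  by rewrite -mulnDr leq_mul2l; apply/orP; right; lia.
rewrite -{1}[k]card_ord -sum_nat_const (bigD1 i) //= [X in _ <= X](bigD1 i) //=.
have : \sum_(j < k | j != i) #|part c0 j| <= \sum_(j < k | j != i) #|T|.-1 by exact: leq_sum.
move=> hs ht; rewrite -(leq_add2r (\sum_(j < k | j != i) #|part c0 j|)).
by apply: leq_trans ht; rewrite leq_add2l.
Qed.

End Maximal.

(** The empty colouring is a packing, so one of maximum cover exists; the edge condition is applied
    to its set [unstable]. *)
Lemma tree_packing : 0 < #|T| ->
  (forall S : {set {set T}}, S \subset E -> k * (ncomp S - 1) <= #|E :\: S|) ->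
  exists c, forall i, tree (edge_graph (part c i)).
Proof.
move=> T_gt0 hE; pose c1 : {ffun {set T} -> option 'I_k} := [ffun _ => None].
have c1_packing : `[< packing c1 >].
  by apply/asboolP => i x y _; rewrite inE ffunE andbF.
have [c0 /asboolP c0_packing c0_max] :=
  @arg_maxnP _ c1 (fun c => `[< packing c >]) (fun c => #|covered c|) c1_packing.
exists c0; apply: maximal_spanning => //; first by move=> c /asboolP; exact: c0_max.
by apply: hE; apply/subsetP => e; rewrite inE => /andP[].
Qed.
End TreePacking.

(** * The tree packing number *)

Section Tau.
Local Open Scope set_scope.

Lemma edgesP (G : sgraph) (x y : G) : ([set x; y] \in edges G) = adj x y.
Proof.
apply/imsetP/idP => [[[u v]]|xy]; last by exists (x, y); rewrite ?inE.
by rewrite inE /= => uv /eq_set2[][-> ->] //; rewrite adj_sym.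
Qed.

Lemma edges_pairs (G : sgraph) : pairs (edges G).
Proof.
move=> e /imsetP[[x y]]; rewrite inE /= => xy ->; exists x, y; split=> //.
by apply: contraTneq xy => ->; rewrite adj_irrefl.
Qed.

(* The Nash-Williams--Tutte condition, with a partition of the vertices
   encoded as the set of components of an edge set [S]. *)
Lemma tau_ge (G : sgraph) k : 1 < #|G| ->
  (forall S : {set {set G}}, S \subset edges G -> k * (ncomp S - 1) <= #|edges G :\: S|) ->
  k <= tau G.
Proof.
move=> G_gt1 /(tree_packing (@edges_pairs G) (ltnW G_gt1))[c c_tree].
(* Nonempty disjoint parts are distinct, so the family of trees has exactly [k] members. *)
have part_neq0 i : part (edges G) c i != set0.
  apply/eqP => p0; have /card_gt1P[x [y [_ _ xy]]] := G_gt1.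
  have [[_ c_conn] _] := c_tree i.
  have : conn (part (edges G) c i) x y by exact: c_conn.
  rewrite p0 => /connectP[[|z p] /=].
    by move=> _ e; rewrite e eqxx in xy.
  by rewrite inE andbF.
have part_inj : injective (part (edges G) c).
  move=> i j eq; have /set0Pn[e ei] := part_neq0 i.
  have := ei; rewrite eq; move: ei; rewrite !inE => /andP[_ /eqP ->] /andP[_].
  by rewrite -[_ == _]/(i == j) => /eqP.
pose P := [set part (edges G) c i | i : 'I_k].
have <- : #|P| = k by rewrite card_imset // card_ord.
apply: (@leq_bigmax_cond _ _ (fun P : {set {set {set G}}} => #|P|)).
apply/andP; split.
  apply/trivIsetP => _ _ /imsetP[i _ ->] /imsetP[j _ ->] neq.
  rewrite -setI_eq0; apply/eqP/setP => e; rewrite !inE.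
  apply/negP => /andP[/andP[_ /eqP ->] /andP[_]].
  by rewrite -[_ == _]/(i == j) => /eqP ij; rewrite ij eqxx in neq.
apply/asboolP => _ /imsetP[i _ ->]; split; [exact: part_sub | exact: c_tree].
Qed.
End Tau.

(** * Counting edges by components *)

Section Counting.
Local Open Scope set_scope.

Definition inc (T : finType) (F : {set {set T}}) x := [set e in F | x \in e].

Definition deg (G : sgraph) (x : G) := #|[set y | adj x y]|.
(** The degree in the complement; these degrees sum to [2 m] in the notation of the overview. *)
Definition codeg (G : sgraph) (x : G) := #|[set y | (x != y) && ~~ adj x y]|.

Lemma sum_inc (T : finType) (F : {set {set T}}) : pairs F -> \sum_x #|inc F x| = 2 * #|F|.
Proof.
move=> pF; under eq_bigr do rewrite -sum1_card.
rewrite (exchange_big_dep (mem F)) /=; last by move=> x e _; rewrite inE => /andP[].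
rewrite mulnC -sum_nat_const; apply: eq_bigr => e Fe.
have [x [y [xy eE]]] := pF e Fe.
transitivity #|e|; last by rewrite eE cards2 xy.
by rewrite -sum1_card; apply: eq_bigl => z; rewrite inE Fe.
Qed.

Lemma inc_edges (G : sgraph) (x : G) : inc (edges G) x = [set [set x; y] | y in [set y | adj x y]].
Proof.
apply/setP => e; rewrite inE; apply/andP/imsetP => [[Ge xe]|[y]].
  have [u [v [uv eE]]] := edges_pairs Ge; subst e.
  rewrite edgesP in Ge; move: xe; rewrite !inE => /orP[] /eqP ->.
    by exists v; rewrite ?inE.
  by exists u; rewrite ?inE 1?adj_sym // setUC.
by rewrite inE => xy ->; rewrite edgesP set21.
Qed.

Lemma card_inc_edges (G : sgraph) (x : G) : #|inc (edges G) x| = deg x.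
Proof.
rewrite inc_edges card_in_imset // => y z; rewrite !inE => xy xz.
by case/eq_set2 => -[// ? ?]; subst.
Qed.

Lemma deg_codeg (G : sgraph) (x : G) : deg x + codeg x = #|G|.-1.
Proof.
rewrite -[#|G|]cardsT (cardsD1 x) inE /= -[RHS](cardsID [set y | adj x y]); congr (_ + _).
  apply: eq_card => y; rewrite !inE andbT; have [->|//] := eqVneq y x.
  by rewrite adj_irrefl.
by apply: eq_card => y; rewrite !inE andbT andbC eq_sym.
Qed.

Lemma card_edges (G : sgraph) :
  2 * #|edges G| + \sum_(x : G) codeg x = #|G| * #|G|.-1.
Proof.
rewrite -sum_inc; last exact: edges_pairs.
rewrite -big_split /= -sum_nat_const; apply: eq_bigr => x _.
by rewrite card_inc_edges deg_codeg.
Qed.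

Section Components.
Variables (T : finType) (S : {set {set T}}).
Hypothesis S_pairs : pairs S.
Let n := #|T|.

(** Each edge of [S] at [x] has its other end in the component of [x]. *)
Lemma card_inc_comp x : #|inc S x| <= #|comp S x|.-1.
Proof.
rewrite (cardsD1 x (comp S x)) comp_id /=.
apply: leq_trans (leq_imset_card (fun y => [set x; y]) _).
apply/subset_leq_card/subsetP => e; rewrite inE => /andP[Se xe].
have [u [v [uv eE]]] := S_pairs Se; subst e; apply/imsetP.
move: xe; rewrite !inE => /orP[] /eqP ?; subst x.
  by exists v; rewrite // !inE eq_sym uv conn_edge.
exists u; last exact: setUC.
by rewrite !inE uv connC conn_edge.
Qed.

Lemma sum_comp (f : {set T} -> nat) :
  \sum_x f (comp S x) = \sum_(A in comp S @: [set: T]) #|A| * f A.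
Proof.
rewrite (partition_big (comp S) (mem (comp S @: [set: T]))) /=; last first.
  by move=> x _; exact: imset_f.
apply: eq_bigr => A /imsetP[z _ ->].
rewrite (eq_bigr (fun _ => f (comp S z))); last by move=> x /eqP ->.
rewrite sum_nat_const; congr (_ * _); apply: eq_card => x.
by rewrite !inE -[LHS]/(comp S x == comp S z) connC; apply/eqP/comp_eqP.
Qed.

Lemma card_sum_comp : \sum_(A in comp S @: [set: T]) #|A| = n.
Proof.
rewrite /n -sum1_card (sum_comp (fun _ => 1)).
by apply: eq_bigr => A _; rewrite muln1.
Qed.

Lemma comp_gt0 A : A \in comp S @: [set: T] -> 0 < #|A|.
Proof. by case/imsetP => x _ ->; apply/card_gt0P; exists x; exact: comp_id. Qed.

Lemma edges_le_sum : 2 * #|S| <= \sum_(A in comp S @: [set: T]) #|A| * #|A|.-1.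
Proof.
rewrite -sum_inc // -(sum_comp (fun A => #|A|.-1)); apply: leq_sum => x _.
exact: card_inc_comp.
Qed.

Lemma card_comp_le A : A \in comp S @: [set: T] -> #|A| + (ncomp S).-1 <= n.
Proof.
move=> CA; rewrite -card_sum_comp (bigD1 A) //= leq_add2l.
rewrite /ncomp (cardsD1 A) CA /= -sum1_card.
rewrite [X in _ <= X](eq_bigl (mem (comp S @: [set: T] :\ A))); last first.
  by move=> B; rewrite !inE andbC.
by apply: leq_sum => B; rewrite inE => /andP[_ /comp_gt0].
Qed.

(** The other components use at least one vertex each, which bounds the size of every component.
    With [t = ncomp S - 1] the right side is twice the binomial coefficient [C(n-t, 2)]. *)
Lemma edges_le_ncomp : 2 * #|S| <= (n - (ncomp S).-1) * (n - ncomp S).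
Proof.
apply: leq_trans edges_le_sum _.
have -> : n - ncomp S = \sum_(A in comp S @: [set: T]) #|A|.-1.
  rewrite -card_sum_comp /ncomp -sum1_card -sumnB => [|A /comp_gt0 //].
  by apply: eq_bigr => A _; rewrite subn1.
rewrite big_distrr /=; apply: leq_sum => A /card_comp_le; rewrite leq_mul2r => le.
by apply/orP; right; lia.
Qed.

(** The extreme split has components of sizes 2 and [n - 2]. *)
Lemma edges_le_two : ncomp S = 2 -> (forall x, 1 < #|comp S x|) ->
  2 * #|S| <= (n - 2) * (n - 3) + 2.
Proof.
rewrite /ncomp => /eqP/cards2P[A [B [AB CE]]] C_gt1.
apply: leq_trans edges_le_sum _.
have gt1 X : X \in comp S @: [set: T] -> 1 < #|X| by case/imsetP => x _ ->.
have := card_sum_comp; have := gt1 A; have := gt1 B; rewrite CE !big_setU1 ?inE // !big_set1.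
rewrite !eqxx orbT /= => /(_ isT) B2 /(_ isT) A2 <-.
by nia.
Qed.
End Components.

(** Here [t] is the number of components minus one. The case [t = 1] is kept apart because minimum
    degree can sharpen it. *)
Lemma tau_ge_codeg (G : sgraph) k (n := #|G|) (m2 := \sum_(x : G) codeg x) : 1 < n ->
  (forall S : {set {set G}}, S \subset edges G -> ncomp S = 2 -> k <= #|edges G :\: S|) ->
  (forall t, 1 < t < n -> m2 + 2 * (k * t) + (n - t) * (n - t).-1 <= n * n.-1) ->
  k <= tau G.
Proof.
move=> n_gt1 two many; apply: tau_ge => // S SE.
have [s1|] := leqP (ncomp S) 1.
  by have -> : ncomp S - 1 = 0 by [lia]; rewrite muln0.
rewrite leq_eqVlt => /orP[/eqP s2|s_gt2].
  by rewrite -s2 muln1; exact: two.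
have pS := pairs_sub SE (@edges_pairs G).
have sn : ncomp S <= n by rewrite /n -cardsT; exact: leq_imset_card.
have /many le : 1 < ncomp S - 1 < n by lia.
have eE : #|edges G| = #|S| + #|edges G :\: S| by rewrite -(cardsID S) (setIidPr SE).
have := edges_le_ncomp pS; have := card_edges G.
have -> : (#|G| - (ncomp S).-1) * (#|G| - ncomp S) = (n - (ncomp S - 1)) * (n - (ncomp S - 1)).-1.
  by congr (_ * _); rewrite /n; lia.
rewrite -(leq_pmul2l (ltn0Sn 1)) eE -/n -/m2.
move: ((n - _) * _) (k * _) (n * _) le => p q r; lia.
Qed.

Lemma two_comp_le (G : sgraph) k (n := #|G|) (m2 := \sum_(x : G) codeg x) : 1 < n ->
  m2 + 2 * k + (n - 1) * (n - 2) <= n * n.-1 ->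
  forall S : {set {set G}}, S \subset edges G -> ncomp S = 2 -> k <= #|edges G :\: S|.
Proof.
move=> n_gt1 hm S SE s2; have pS := pairs_sub SE (@edges_pairs G).
have := edges_le_ncomp pS; have := card_edges G.
have : #|edges G| = #|S| + #|edges G :\: S| by rewrite -(cardsID S) (setIidPr SE).
by rewrite s2 /= -/n -/m2; lia.
Qed.

(** If a component is a single vertex, all its edges, at least [k], lie outside [S]; otherwise both
    components have two vertices or more. *)
Lemma two_comp_mindeg (G : sgraph) k (n := #|G|) (m2 := \sum_(x : G) codeg x) : 1 < n ->
  (forall x : G, k <= deg x) ->
  m2 + 2 * k + (n - 2) * (n - 3) + 2 <= n * n.-1 ->
  forall S : {set {set G}}, S \subset edges G -> ncomp S = 2 -> k <= #|edges G :\: S|.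
Proof.
move=> n_gt1 dk hm S SE s2; have pS := pairs_sub SE (@edges_pairs G).
have [x c1|C_gt1] := pickP (fun x => #|comp S x| <= 1).
  apply: leq_trans (dk x) _; rewrite -card_inc_edges; apply/subset_leq_card/subsetP => e.
  rewrite !inE => /andP[Ge xe]; rewrite Ge andbT; apply/negP => Se.
  have := card_inc_comp pS x; rewrite (_ : #|comp S x|.-1 = 0); last by lia.
  by rewrite leqn0 cards_eq0 => /eqP/setP/(_ e); rewrite !inE Se xe.
have := edges_le_two pS s2; have := card_edges G.
have : #|edges G| = #|S| + #|edges G :\: S| by rewrite -(cardsID S) (setIidPr SE).
have gt1 x : 1 < #|comp S x| by rewrite ltnNge C_gt1.
rewrite -/n -/m2 => h1 h2 /(_ gt1); lia.
Qed.
End Counting.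

(** * Bounds on the distance spectral radius *)

Section NumericBounds.
Local Open Scope ring_scope.
Variable R : realType.
Implicit Types G H : sgraph.

(** Every other vertex contributes at least 1, and every non-neighbour at least 2. *)
Lemma transmission_ge G (u : G) :
  #|G|.-1%:R + (codeg u)%:R <= \sum_v (dist u v)%:R :> R.
Proof.
rewrite -natrD -natr_sum ler_nat; have -> : #|G|.-1 = \sum_(v : G) nat_of_bool (u != v).
  rewrite -sum1_card (bigD1 u) //= [RHS](bigD1 u) //= eqxx add0n.
  by apply: eq_bigr => v; rewrite eq_sym => ->.
rewrite /codeg -sum1_card [X in (_ + X <= _)%N]big_mkcond -big_split /=; apply: leq_sum => v _.
rewrite inE; have [->|uv] /= := eqVneq u v; first by [].
by case: ifP => uv'; [exact: dist_ge2 | rewrite lt0n dist_eq0].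
Qed.

Lemma rhoD_ge_codeg G : (1 < #|G|)%N ->
  (#|G| * #|G|.-1 + \sum_(u : G) codeg u)%:R <= rhoD R G * #|G|%:R.
Proof.
move=> G_gt1; have := rhoD_rayleigh G_gt1 (fun _ => 1 : R).
under [X in _ <= _ * X]eq_bigr do rewrite expr1n.
rewrite sumr_const; apply: le_trans.
rewrite natrD natrM mulr_natl -sumr_const natr_sum -big_split /=.
apply: ler_sum => u _; apply: le_trans (transmission_ge u) _.
by apply: ler_sum => v _; rewrite !mulr1.
Qed.

Lemma rhoD_ge_codeg_sqr G : (1 < #|G|)%N ->
  (\sum_(u : G) (#|G|.-1 + codeg u) ^ 2)%:R <= rhoD R G ^+ 2 * #|G|%:R.
Proof.
move=> G_gt1; have := rhoD_sqr G_gt1 (fun _ => 1 : R).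
under [X in _ <= _ * X]eq_bigr do rewrite expr1n.
rewrite sumr_const; apply: le_trans; rewrite natr_sum.
apply: ler_sum => u _; rewrite natrX ler_pXn2r ?nnegrE ?ler0n //.
  by rewrite natrD; apply: le_trans (transmission_ge u) _; apply: ler_sum => v _; rewrite mulr1.
by apply: sumr_ge0 => v _; rewrite mulr1.
Qed.

(** In diameter at most 2 the distance matrix is the all-ones matrix minus the identity plus the
    adjacency matrix of the complement; the identity causes the shift to [c + 1]. *)
Lemma rhoD_le_diam2 G (x : G -> R) (c : R) : (1 < #|G|)%N ->
  (forall u v : G, u != v -> ~~ adj u v -> exists w, adj u w && adj w v) ->
  (forall u, 0 < x u) ->
  (forall u, \sum_v x v + \sum_(v | (u != v) && ~~ adj u v) x v <= (c + 1) * x u) ->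
  rhoD R G <= c.
Proof.
move=> G_gt1 diam2 x_gt0 xc; apply: (rhoD_le G_gt1 x_gt0) => u.
have := xc u; rewrite mulrDl mul1r -lerBlDr; apply: le_trans.
rewrite lerBrDr [X in _ <= _ + X]big_mkcond -big_split /=.
rewrite (bigD1 u) //= [X in _ <= X](bigD1 u) //= eqxx addr0 [X in _ <= X]addrC lerD2r.
have /eqP -> : dist u u == 0%N by rewrite dist_eq0.
rewrite mul0r add0r; apply: ler_sum => v vu; rewrite eq_sym vu /=.
case: ifP => [uv|/negbFE /dist_adj ->]; last by rewrite mul1r addr0.
have uv' : u != v by rewrite eq_sym.
have [w /andP[uw wv]] := diam2 u v uv' uv.
rewrite -mulr2n -[leRHS]mulr_natl ler_pM2r // ler_nat.
exact: dist_le2 uw wv.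
Qed.

(** * Radius of the extremal graph for large order *)

Section Kite.
Variables a q : nat.
Let n := (a + q.+1)%N.
Local Notation K := (gjoin (complete_graph a) (gunion (complete_graph q) (complete_graph 1))).

Lemma card_kite : #|K| = n.
Proof. by rewrite card_sum card_sum !card_ord addn1. Qed.

Lemma kite_nadj (u v : K) : (u != v) && ~~ adj u v =
  match u, v with
  | inr (inl _), inr (inr _) | inr (inr _), inr (inl _) => true
  | _, _ => false
  end.
Proof.
case: u => [i|[i|i]]; case: v => [j|[j|j]] //=; rewrite ?andbF // negbK;
  by case: (i =P j) => [->|_]; rewrite ?eqxx ?andbF.
Qed.

Lemma kite_diam2 (u v : K) : (0 < a)%N -> u != v -> ~~ adj u v -> exists w, adj u w && adj w v.
Proof.
move=> a_gt0 uv nuv; exists (inl (Ordinal a_gt0)).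
move: uv nuv; case: u => [i|[i|i]]; case: v => [j|[j|j]] //= uv.
- by rewrite negbK => /eqP e; rewrite e eqxx in uv.
Qed.

(* With [p = c + 1], the weights solve the eigenvalue equations of [K] up to
   a common defect, whose sign is that of the hypothesis. *)
Lemma rhoD_kite_le (c : R) (p := c + 1) : (0 < a)%N -> (0 < q)%N -> 0 < p -> q%:R < p ^+ 2 ->
  n%:R * (p ^+ 2 - q%:R) + (2 * p * q%:R + q%:R ^+ 2 + q%:R) <= p * (p ^+ 2 - q%:R) ->
  rhoD R K <= c.
Proof.
move=> a_gt0 q_gt0 p_gt0 qp hp.
pose x (u : K) : R := match u with
  | inl _ => p ^+ 2 - q%:R | inr (inl _) => p * (p + 1) | inr (inr _) => p * (p + q%:R) end.
have q0 : 0 < q%:R :> R by rewrite ltr0n.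
apply: (@rhoD_le_diam2 _ x).
- by rewrite card_kite /n; lia.
- by move=> u v uv nuv; exact: kite_diam2.
- by case=> [i|[i|i]] /=; nra.
have sE (P : pred K) : \sum_(v | P v) x v = \sum_(i : 'I_a | P (inl i)) (p ^+ 2 - q%:R)
   + (\sum_(i : 'I_q | P (inr (inl i))) p * (p + 1)
      + \sum_(i : 'I_1 | P (inr (inr i))) p * (p + q%:R)).
  by rewrite big_sumType; congr (_ + _); rewrite big_sumType.
have nE : n%:R = a%:R + q%:R + 1 :> R by rewrite /n addnS -addn1 !natrD.
move=> u; under [X in _ + X]eq_bigl do rewrite kite_nadj.
rewrite !sE !sumr_const !card_ord -/p.
have dT m : #|(xpredT : pred 'I_m)| = m by rewrite -[RHS]card_ord; exact: eq_card.
have dF m : #|(xpred0 : pred 'I_m)| = 0%N by exact: card0.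
rewrite nE in hp.
case: u => [i|[i|i]] /=; rewrite ?dT !dF.
- rewrite !mulr0n.
  by apply: le_trans hp; rewrite le_eqVlt; apply/orP; left; apply/eqP; ring.
- rewrite !mulr0n -subr_ge0.
  move: hp; rewrite -subr_ge0 => hp; apply: le_trans hp _.
  by rewrite le_eqVlt; apply/orP; left; apply/eqP; ring.
- rewrite !mulr0n -subr_ge0.
  move: hp; rewrite -subr_ge0 => hp; apply: le_trans hp _.
  by rewrite le_eqVlt; apply/orP; left; apply/eqP; ring.
Qed.
End Kite.

(** * Radius of the complement of a path and a matching *)

Section PathMatching.
Variable m : nat.
Local Notation U := (gunion (path_graph 3) (copies m (path_graph 2))).
Let n := (m.*2 + 3)%N.

Lemma card_path_matching : #|gcompl U| = n.
Proof. by rewrite card_sum card_prod !card_ord addnC muln2. Qed.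

Lemma gcompl_nadj (u v : gcompl U) :
  (u != v) && ~~ adj u v = adj (u : U) v.
Proof.
rewrite /=; have [->|_] := eqVneq u v; last by rewrite negbK.
exact/esym/(@adj_irrefl U).
Qed.

Lemma path_matching_diam2 (u v : gcompl U) : (0 < m)%N -> u != v -> ~~ adj u v ->
  exists w, adj u w && adj w v.
Proof.
move=> m_gt0 uv nuv; have : adj (u : U) v by rewrite -gcompl_nadj uv.
case: u v {uv nuv} => [i|i] [j|j] //= _; first by exists (inr (Ordinal m_gt0, ord0)).
by exists (inl ord0).
Qed.

Lemma rhoD_path_matching_le (c : R) : (0 < m)%N -> 1 < c ->
  c + 3 <= (c - n%:R) * (c ^+ 2 + 2 * c - 1) -> rhoD R (gcompl U) <= c.
Proof.
(* With these weights the inequalities at all three types of vertices have the same slack, that of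
   the hypothesis; the centre of the path needs [N + 2 = (c + 1) ^+ 2]. *)
move=> m_gt0 c_gt1 hc; pose N := c ^+ 2 + 2 * c - 1.
pose x (u : gcompl U) : R := match u with
  | inl i => if i == 1%N :> nat then N + c + 1 else N + 1 | inr _ => N end.
apply: (@rhoD_le_diam2 _ x).
- by rewrite card_path_matching /n; lia.
- by move=> u v; exact: path_matching_diam2.
- by case=> [i|i] /=; [case: ifP => _ |]; rewrite /N; nra.
have s3 (F : 'I_3 -> R) : \sum_i F i =
    F (@Ordinal 3 0 isT) + F (@Ordinal 3 1 isT) + F (@Ordinal 3 2 isT).
  rewrite !big_ord_recl big_ord0 addr0 !addrA.
  by congr (_ + _); [congr (_ + _)|]; congr (F _); exact: val_inj.
have sE (P : pred U) : \sum_(v | P v) x v =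
   (if P (inl (@Ordinal 3 0 isT)) then N + 1 else 0)
   + (if P (inl (@Ordinal 3 1 isT)) then N + c + 1 else 0)
   + (if P (inl (@Ordinal 3 2 isT)) then N + 1 else 0)
   + \sum_(i : 'I_m * 'I_2 | P (inr i)) N.
  by rewrite big_sumType /= big_mkcond s3.
have nE : n%:R = 2 * m%:R + 3 :> R by rewrite /n natrD -mul2n natrM.
rewrite nE in hc; move=> u; under [X in _ + X]eq_bigl do rewrite gcompl_nadj.
rewrite !sE !sumr_const card_prod !card_ord.
have dF (A : finType) : #|(xpred0 : pred A)| = 0%N by exact: card0.
(* The only complement neighbour of a matching vertex is the other end of its edge. *)
have d1 (i : 'I_m) (j : 'I_2) : #|[pred v : 'I_m * 'I_2 |
    (i == v.1) && ((j.+1 == v.2) || (v.2.+1 == j))]| = 1%N.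
  apply: (@eq_card1 _ (i, rev_ord j)) => -[i' j']; rewrite !inE xpair_eqE eq_sym /=.
  by congr (_ && _); case: j j' => [[|[|//]] ?] [[|[|//]] ?].
case: u => [[[|[|[|//]]] i]|[i j]] /=; rewrite ?dF ?d1 mulrnA -subr_ge0;
  move: hc; rewrite -subr_ge0 => hc; apply: le_trans hc _;
  by rewrite le_eqVlt /N; apply/orP; left; apply/eqP; ring.
Qed.
End PathMatching.
End NumericBounds.

(** * Extremal graphs *)

Section Embeddings.
Local Open Scope set_scope.

Lemma subset_of_card (T : finType) (N : {set T}) q : q <= #|N| ->
  exists2 B : {set T}, B \subset N & #|B| = q.
Proof.
move=> qN; exists [set y in take q (enum N)].
  by apply/subsetP => y; rewrite inE => /mem_take; rewrite mem_enum.
rewrite cardsE (card_uniqP _) ?take_uniq ?enum_uniq // size_take -cardE.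
by case: ltnP => //; lia.
Qed.

(** Since [x] has at least [q] non-neighbours, [q] of them can form the clique [B] not joined to
    [x]; the other [a] vertices take the dominating role, where every adjacency is allowed. *)
Lemma kite_embedding (G : sgraph) (x : G) a q : #|G| = a + q.+1 -> deg x <= a ->
  exists2 h : gjoin (complete_graph a) (gunion (complete_graph q) (complete_graph 1)) -> G,
    injective h & forall u v, adj (h u) (h v) -> adj u v.
Proof.
move=> Gn dx; have qN : q <= #|[set y | (x != y) && ~~ adj x y]|.
  by have := deg_codeg x; rewrite /codeg Gn; lia.
have [B /subsetP BN Bq] := subset_of_card qN.
have xB : x \notin B by apply/negP => /BN; rewrite inE eqxx.
pose A := ~: (x |: B).
have Aa : #|A| = a by rewrite cardsCs setCK cardsU1 xB Bq Gn; lia.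
pose hA i : G := enum_val (cast_ord (esym Aa) i).
pose hB i : G := enum_val (cast_ord (esym Bq) i).
have hAA i : hA i \in A by exact: enum_valP.
have hBB i : hB i \in B by exact: enum_valP.
have hAI : injective hA by move=> i j /enum_val_inj/cast_ord_inj.
have hBI : injective hB by move=> i j /enum_val_inj/cast_ord_inj.
have hAx i : hA i != x by have := hAA i; rewrite !inE negb_or => /andP[].
have hBx i : hB i != x by apply: contraNneq xB => <-.
have hAB i j : hA i != hB j.
  by apply: contraTneq (hBB j) => <-; have := hAA i; rewrite !inE negb_or => /andP[].
exists (fun u => match u with inl i => hA i | inr (inl i) => hB i | inr (inr _) => x end).
  case=> [i|[i|i]] [j|[j|j]] => [/hAI->|/eqP|/eqP|/eqP|/hBI->|/eqP|/eqP|/eqP|_] //.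
  - by rewrite (negPf (hAB _ _)).
  - by rewrite (negPf (hAx _)).
  - by rewrite eq_sym (negPf (hAB _ _)).
  - by rewrite (negPf (hBx _)).
  - by rewrite eq_sym (negPf (hAx _)).
  - by rewrite eq_sym (negPf (hBx _)).
  - by rewrite (ord1 i) (ord1 j).
case=> [i|[i|i]] [j|[j|j]] //=.
- by apply: contraTneq => ->; rewrite adj_irrefl.
- by apply: contraTneq => ->; rewrite adj_irrefl.
- by have := BN _ (hBB i); rewrite inE adj_sym => /andP[_ /negPf ->].
- by have := BN _ (hBB j); rewrite inE => /andP[_ /negPf ->].
- by rewrite adj_irrefl.
Qed.

Lemma del_edge_embedding (G : sgraph) n (u v : G) (e : {set complete_graph n}) :
  #|G| = n -> u != v -> ~~ adj u v -> e \in edges (complete_graph n) ->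
  exists2 h : del_edge e -> G, injective h & forall x y, adj (h x) (h y) -> adj x y.
Proof.
move=> Gn uv nuv /edges_pairs[a [b [ab ->]]].
pose g (i : 'I_n) : G := enum_val (cast_ord (esym Gn) i).
have gI : injective g by move=> i j /enum_val_inj/cast_ord_inj.
(* The first transposition sends the image of [a] to [u]; the second sends [w], now the image of
   [b], to [v] and fixes [u]. *)
pose w := tperm (g a) u (g b).
pose h i := tperm w v (tperm (g a) u (g i)).
have wu : w != u.
  apply: contra ab => /eqP wu; apply/eqP/gI/(@perm_inj _ (tperm (g a) u)).
  by rewrite -/w wu tpermL.
have ha : h a = u by rewrite /h tpermL tpermD // eq_sym.
have hb : h b = v by rewrite /h tpermL.
have hI : injective h by move=> i j /perm_inj/perm_inj/gI.
exists h => // x y hxy.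
have xy : x != y by apply: contraTneq hxy => ->; rewrite adj_irrefl.
apply/andP; split; first exact: xy.
apply/setD1P; split; last by rewrite (@edgesP (complete_graph n)).
apply: contraTneq hxy => /eq_set2[][-> ->]; rewrite ha hb //.
by rewrite adj_sym.
Qed.

(** Positive complement degrees summing to one more than the order leave a single vertex [c] of
    complement degree 2 and degree 1 elsewhere: a path centred at [c] and a matching. *)
Lemma path_matching_iso (G : sgraph) m : #|G| = m.*2 + 3 ->
  (forall u : G, 0 < codeg u) -> \sum_(u : G) codeg u = #|G|.+1 ->
  giso G (gcompl (gunion (path_graph 3) (copies m (path_graph 2)))).
Proof.
move=> Gn cod_gt0 cod_sum; pose na (u : G) := [set v | (u != v) && ~~ adj u v].
have naC u v : (v \in na u) = (u \in na v) by rewrite !inE eq_sym adj_sym.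
have naE u : #|na u| = codeg u by [].
have sum1 : \sum_(u : G) (codeg u).-1 = 1.
  have : \sum_(u : G) (codeg u).-1 + #|G| = #|G|.+1.
    rewrite -cod_sum -[X in _ + X]sum1_card -big_split; apply: eq_bigr => u _ /=.
    by rewrite addn1 prednK.
  by lia.
have [c c2] : exists c : G, codeg c > 1.
  apply/existsP; apply: contra_eqT sum1; rewrite negb_exists => /forallP no.
  by rewrite big1 // => u _; have := no u; lia.
have rest := sum1; rewrite (bigD1 c) //= in rest.
have codc : codeg c = 2 by lia.
have cod1 u : u != c -> codeg u = 1.
  move=> uc; have : \sum_(u | u != c) (codeg u).-1 = 0 by lia.
  by move/eqP; rewrite sum_nat_eq0 => /forall_inP/(_ u uc)/eqP; have := cod_gt0 u; lia.
have /eqP/cards2P[l1 [l2 [l12 nac]]] : #|na c| = 2 by rewrite naE.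
(* [f u] will be the unique non-neighbour of [u]; at [c] its value is arbitrary. *)
have mu u : exists v, u != c -> na u = [set v].
  have [->|uc] := eqVneq u c; first by exists c.
  have /eqP/cards1P[v ->] : #|na u| = 1 by rewrite naE cod1.
  by exists v.
have [f fE] := choice mu.
have naf u v : u != c -> (v \in na u) = (v == f u) by move=> uc; rewrite fE // inE.
have nac_c : c \notin na c by rewrite inE eqxx.
have [l1c l2c] : l1 != c /\ l2 != c.
  by split; apply: contraNneq nac_c => e; rewrite -{1}e nac !inE eqxx ?orbT.
have fl1 : f l1 = c by apply/esym/eqP; rewrite -naf // naC nac set21.
have fl2 : f l2 = c by apply/esym/eqP; rewrite -naf // naC nac set22.
(* Off the path, [f] is an involution without fixed points. *)
pose O := ~: (c |: [set l1; l2]).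
have OP u : u \in O -> [/\ u != c, u != l1 & u != l2].
  by rewrite !inE !negb_or => /and3P[].
have fK u : u \in O -> f (f u) = u.
  move=> /OP[uc u1 u2]; have : u \in na (f u) by rewrite -naC naf.
  have [->|fuc] := eqVneq (f u) c; last by rewrite naf // => /eqP.
  by rewrite nac !inE (negPf u1) (negPf u2).
have fO u : u \in O -> f u \in O.
  move=> uO; have [uc u1 u2] := OP u uO; rewrite !inE !negb_or.
  have fuu : u \in na (f u) by rewrite -naC naf.
  apply/and3P; split; apply/eqP => e.
  - by move: fuu; rewrite e nac !inE (negPf u1) (negPf u2).
  - by move: (fK u uO); rewrite e fl1 => e'; rewrite e' eqxx in uc.
  - by move: (fK u uO); rewrite e fl2 => e'; rewrite e' eqxx in uc.
have fne u : u \in O -> f u != u.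
  move=> /OP[uc _ _]; apply/eqP => e; have : f u \in na u by rewrite naf.
  by rewrite e inE eqxx.
(* An arbitrary linear order orients the pairs of the matching. *)
pose R := [set u in O | enum_rank u < enum_rank (f u)].
have RO u : u \in R -> u \in O by rewrite inE => /andP[].
have fR u : u \in O -> (f u \in R) = (u \notin R).
  move=> uO; rewrite /R [LHS]in_set [X in ~~ X]in_set fO // uO fK //= -leqNgt [RHS]leq_eqVlt.
  by rewrite (inj_eq (@ord_inj _)) (inj_eq enum_rank_inj) (negPf (fne _ uO)).
have Rm : #|R| = m.
  have : #|O| = #|R| + #|R|.
    rewrite -(cardsID R O); congr (_ + _).
      by congr #|pred_of_set _|; apply/setIidPr/subsetP.
    have <- : #|f @: R| = #|R|.
      by apply: card_in_imset => u v /RO uO /RO vO e; rewrite -(fK u) // e fK.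
    congr #|pred_of_set _|; apply/setP => u; rewrite inE; apply/andP/imsetP => [[nR uO]|[v vR ->]].
      by exists (f u); rewrite ?fK // fR.
    have vO := RO _ vR; rewrite fO //; split=> //.
    by rewrite fR // negbK.
  have : #|O| + 3 = #|G|.
    by rewrite -(cardsC O) setCK cardsU1 cards2 l12 !inE negb_or !(eq_sym c) l1c l2c.
  by rewrite Gn; lia.
pose r (i : 'I_m) : G := enum_val (cast_ord (esym Rm) i).
have rR i : r i \in R by exact: enum_valP.
have rO i : r i \in O by exact: RO.
have rI : injective r by move=> i j /enum_val_inj/cast_ord_inj.
pose U := gunion (path_graph 3) (copies m (path_graph 2)).
pose h (u : U) : G := match u with
  | inl i => if i == 1 :> nat then c else if i == 0 :> nat then l1 else l2
  | inr (i, j) => if j == 0 :> nat then r i else f (r i) end.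
have hO (i : 'I_m * 'I_2) : h (inr i) \in O by case: i => i j /=; case: ifP => _ //; exact: fO.
have hI : injective h.
  have hlr i j : h (inl i) <> h (inr j).
    move=> e; have /OP[] := hO j; rewrite -e /=.
    by case: ifP; rewrite ?eqxx //; case: ifP; rewrite ?eqxx.
  case=> [i|[i j]] [i'|[i' j']] e.
  - congr inl; apply: val_inj; move: e => /=.
    case: i i' => [[|[|[|//]]] ?] [[|[|[|//]]] ?] //= /eqP;
      by rewrite ?(negPf l12) ?(negPf l1c) ?(negPf l2c) 1?eq_sym ?(negPf l12) ?(negPf l1c) ?(negPf l2c).
  - by case: (hlr _ _ e).
  - by case: (hlr _ _ (esym e)).
  - have rfr k k' : r k <> f (r k').
      by move=> e'; have := rR k; rewrite e' fR // rR.
    case: j j' e => [[|[|//]] ?] [[|[|//]] ?] //= => [/rI ->|/rfr|/esym/rfr|e] //.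
    + by congr (inr (_, _)); exact: val_inj.
    + congr (inr (_, _)); last exact: val_inj.
      by apply: rI; rewrite -(fK (r i)) // e fK.
have [g hK gK] : bijective h.
  by apply: inj_card_bij hI _; rewrite Gn -(card_path_matching m).
have hna u v : (h v \in na (h u)) = adj u v.
  pose p3 i (lt : i < 3) : U := inl (Ordinal lt).
  have h0 : h (p3 0 isT) = l1 by []. have h1 : h (p3 1 isT) = c by [].
  have h2 : h (p3 2 isT) = l2 by [].
  case: u => [[[|[|[|//]]] lt]|[i [[|[|//]] lt]]] /=.
  - rewrite naf // fl1 -h1 (inj_eq hI); case: v => [[[|[|[|//]]] ?]|[i' j']] //.
  - rewrite nac !inE -h0 -h2 !(inj_eq hI); case: v => [[[|[|[|//]]] ?]|[i' j']] //.
  - rewrite naf // fl2 -h1 (inj_eq hI); case: v => [[[|[|[|//]]] ?]|[i' j']] //.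
  - have ric : r i != c by have [] := OP _ (rO i).
    rewrite naf // -[f (r i)]/(h (inr (i, ord_max))) (inj_eq hI).
    case: v => [//|[i' j']]; rewrite -[LHS]/((i', j') == (i, ord_max)) xpair_eqE eq_sym.
    by congr (_ && _); case: j' => [[|[|//]] ?].
  - have fric : f (r i) != c by have [] := OP _ (fO _ (rO i)).
    rewrite naf // fK // -[r i]/(h (inr (i, ord0))) (inj_eq hI).
    case: v => [//|[i' j']]; rewrite -[LHS]/((i', j') == (i, ord0)) xpair_eqE eq_sym.
    by congr (_ && _); case: j' => [[|[|//]] ?].
exists g; first by exists h.
move=> x y; rewrite -[in RHS](gK x) -[in RHS](gK y) /=.
move: (g x) (g y) => u v; have := hna u v; rewrite inE (inj_eq hI) /= => <-.
have [->|_] := eqVneq u v; first by rewrite adj_irrefl.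
by rewrite /= negbK.
Qed.
End Embeddings

.

(** * Strict comparison with the extremal radii *)

Section Numerics.
Local Open Scope ring_scope.
Variable R : realType.

Lemma kite_radius_lt (G : sgraph) (k n : nat) : (2 <= k)%N -> (2 * k + 2 <= n)%N -> #|G| = n ->
  (4 * (n - k) - 4 <= \sum_(u : G) codeg u)%N ->
  rhoD R (gjoin (complete_graph (k - 1)) (gunion (complete_graph (n - k)) (complete_graph 1)))
    < rhoD R G.
Proof.
move=> k2 kn Gn hm; set q := (n - k)%N in hm *.
have G_gt1 : (1 < #|G|)%N by lia.
have := rhoD_ge_codeg R G_gt1; rewrite Gn => lb.
(* The Rayleigh bound is [N - 1 + (4 Q - 4) / N]; lowering the numerator by 1 gives a threshold
   strictly below it that still bounds the extremal radius. *)
pose N : R := n%:R; pose Q : R := q%:R; pose d := (4 * Q - 5) / N.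
have hQ : 4 <= Q by rewrite ler_nat /q; lia.
have hN1 : Q + 2 <= N by rewrite -natrD ler_nat /q; lia.
(* This is [2 k + 2 <= n] with [k] eliminated. *)
have hN2 : N + 2 <= 2 * Q by rewrite -natrM -natrD ler_nat /q; lia.
have N_gt0 : 0 < N by lra.
have Nd : N * d = 4 * Q - 5 by rewrite mulrC divfK // gt_eqF.
have d1 : 1 <= d by rewrite ler_pdivlMr // mul1r; lra.
have lb' : N * (N - 1) + (4 * Q - 4) <= rhoD R G * N.
  apply: le_trans lb; rewrite natrD natrM lerD //.
    by rewrite -(natrB _ (_ : 1 <= n)%N) ?subn1 //; lia.
  by rewrite -(natrM _ 4) -natrB ?ler_nat; lia.
apply: le_lt_trans (_ : N - 1 + d < _); last first.
  rewrite -(ltr_pM2r N_gt0).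
  apply: lt_le_trans lb'; rewrite mulrDl [d * N]mulrC Nd; lra.
have nE : (k - 1 + q.+1)%N = n by rewrite /q; lia.
apply: rhoD_kite_le; rewrite ?nE -/N -/Q.
- by lia.
- by rewrite /q; lia.
- by lra.
- by nra.
have -> : N - 1 + d + 1 = N + d by ring.
rewrite -subr_ge0.
have -> : (N + d) * ((N + d) ^+ 2 - Q)
    - (N * ((N + d) ^+ 2 - Q) + (2 * (N + d) * Q + Q ^+ 2 + Q))
  = N * (N * d) + 2 * d * (N * d) + d ^+ 3 - 3 * d * Q - 2 * N * Q - Q ^+ 2 - Q by ring.
rewrite Nd; have d3 : 0 <= d ^+ 3 by apply: exprn_ge0; lra.
(* Lowering [d] to 1 and [N] to [Q + 2] in the terms linear in them leaves [Q^2 + 3 Q - 20],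
   positive for [Q >= 4]. *)
have h1 : 0 <= (d - 1) * (5 * Q - 10) by apply: mulr_ge0; lra.
have h2 : 0 <= (N - (Q + 2)) * (2 * Q - 5) by apply: mulr_ge0; lra.
nra.
Qed.

Lemma path_matching_radius_lt (G : sgraph) (k : nat) : (2 <= k)%N -> #|G| = (2 * k + 1)%N ->
  (2 * k + 2 <= \sum_(u : G) codeg u)%N ->
  ~ giso G (gcompl (gunion (path_graph 3) (copies (k - 1) (path_graph 2)))) ->
  rhoD R (gcompl (gunion (path_graph 3) (copies (k - 1) (path_graph 2)))) < rhoD R G.
Proof.
move=> k2 Gn hm niso; set n := #|G| in Gn.
have G_gt1 : (1 < #|G|)%N by lia.
have r_gt0 := rhoD_gt0 R G_gt1.
pose N : R := n%:R; pose e : R := N^-1 + 5 / 4 * N^-1 ^+ 2.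
(* The two radii are [N + 1/N + 1/N^2 + ...] and, when the complement has an
   isolated vertex, at least [N + 1/N + 3/(2N^2) + ...]; [N + e] separates them. *)
have N5 : 5 <= N by rewrite ler_nat; lia.
have i_gt0 : 0 < N^-1 by rewrite invr_gt0; lra.
have N_gt0 : 0 < N by lra.
have Ni : N * N^-1 = 1 by rewrite divff // gt_eqF.
have i_le : N^-1 <= 1 / 5 by rewrite -(ler_pM2l N_gt0) Ni; lra.
have Ne : N * e = 1 + 5 / 4 * N^-1.
  by rewrite /e mulrDr Ni -[5 / 4 * N^-1]mul1r -Ni; ring.
have e_gt0 : 0 < e by rewrite /e; nra.
have e_le : e <= 1 / 4 by rewrite /e; nra.
apply: le_lt_trans (_ : N + e < _).
  apply: rhoD_path_matching_le; [lia | lra |].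
  have -> : ((k - 1).*2 + 3)%N = n by lia.
  rewrite -/N [N + e - N]addrAC subrr add0r -subr_ge0.
  have -> : e * ((N + e) ^+ 2 + 2 * (N + e) - 1) - (N + e + 3)
    = N * (N * e) + 2 * e * (N * e) + e ^+ 3 + 2 * (N * e) + 2 * e ^+ 2 - 2 * e - N - 3 by ring.
  have -> : N * (N * e) = N + 5 / 4 by rewrite Ne mulrDr mulr1 mulrCA Ni mulr1.
  have e3 : 0 <= e ^+ 3 by rewrite exprn_ge0 // ltW.
  rewrite Ne; nra.
have cE := card_edges G; rewrite -/n in cE.
have [big|small] := leqP (2 * k + 4) (\sum_(u : G) codeg u).
  have := rhoD_ge_codeg R G_gt1; rewrite -/n -/N => lb.
  rewrite -(ltr_pM2r N_gt0).
  apply: lt_le_trans lb; rewrite mulrDl [e * N]mulrC Ne.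
  apply: lt_le_trans (_ : N * N + 3 <= _); first by lra.
  by rewrite -natrM -natrD ler_nat; nia.
(* By [cE] the sum is even, which excludes [2 k + 3]. *)
have sE : (\sum_(u : G) codeg u = n.+1)%N.
  by move: cE hm small; rewrite Gn; move: (\sum_u _)%N (#|edges G|) => s E; nia.
have [/forallP cod_gt0|] := boolP [forall u : G, 0 < codeg u]%N.
  by case: niso; apply: path_matching_iso; rewrite -/n //; lia.
rewrite negb_forall => /existsP[u0]; rewrite -leqNgt leqn0 => /eqP u00.
have lb := rhoD_ge_codeg_sqr R G_gt1; rewrite -/n in lb.
have sq : (n * (n ^ 2 + 2) + 3 <= \sum_(u : G) (n.-1 + codeg u) ^ 2)%N.
  rewrite (bigD1 u0) //= u00 addn0.
  have srest : (\sum_(u : G | u != u0) codeg u = n.+1)%N.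
    by rewrite -sE [in RHS](bigD1 u0) //= u00.
  have crest : (\sum_(u : G | u != u0) 1 = n.-1)%N.
    by rewrite sum1_card; have := cardC1 u0; rewrite -/n => <-; apply: eq_card.
  (* The quadratic terms are bounded by [3d <= d^2 + 2], sharp at [d = 1, 2]. *)
  have : (\sum_(u : G | u != u0) (n.-1 ^ 2 * 1 + (2 * n.-1 + 3) * codeg u) <=
    \sum_(u : G | u != u0) ((n.-1 + codeg u) ^ 2 + 2 * 1))%N.
    apply: leq_sum => u _; rewrite sqrnD.
    have : (3 * codeg u <= codeg u ^ 2 + 2)%N.
      by case: (codeg u) => [|[|c]] //; rewrite -!mulnn; nia.
    by lia.
  rewrite !big_split /= -!big_distrr /= srest crest.
  by rewrite -!mulnn; nia.
have lbR : N * (N ^+ 2 + 2) + 3 <= rhoD R G ^+ 2 * N.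
  by apply: le_trans lb; rewrite -natrX -natrD -natrM -natrD ler_nat.
rewrite -(ltr_pXn2r (ltn0Sn 1)) ?nnegrE; [|lra|lra].
rewrite -(ltr_pM2r N_gt0).
apply: lt_le_trans lbR.
have -> : (N + e) ^+ 2 * N = N * N ^+ 2 + 2 * (N * (N * e)) + e * (N * e) by ring.
have -> : N * (N * e) = N + 5 / 4 by rewrite Ne mulrDr mulr1 mulrCA Ni mulr1.
rewrite Ne; nra.
Qed.
End Numerics.

(** * The three ranges of the order *)

Theorem theorem1p2 (R : realType) (k n : nat) (G : sgraph)
    (k_ge2 : 2 <= k) (G_conn : gconnected G) (G_order : #|G| = n)
    (n_ge2k : 2 * k <= n) :
  (n = 2 * k -> forall e : {set complete_graph n},
     e \in edges (complete_graph n) ->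
     (rhoD R G <= rhoD R (del_edge e))%R ->
     ~ giso G (del_edge e) -> k <= tau G) /\
  (n = 2 * k + 1 ->
     let H := gcompl (gunion (path_graph 3) (copies (k - 1) (path_graph 2))) in
     (rhoD R G <= rhoD R H)%R ->
     ~ giso G H -> k <= tau G) /\
  (2 * k + 2 <= n ->
     let H := gjoin (complete_graph (k - 1))
                    (gunion (complete_graph (n - k)) (complete_graph 1)) in
     (rhoD R G <= rhoD R H)%R ->
     ~ giso G H -> k <= tau G).
Proof.
have G_gt1 : 1 < #|G| by lia.
split=> [nE e eE le_rho niso|]; last split=> [nE H le_rho niso|n_ge H le_rho niso].
- have [/existsP[u /existsP[v /andP[uv nuv]]]|complete] :=
    boolP [exists u : G, exists v : G, (u != v) && ~~ adj u v].
    have [h hI hadj] := del_edge_embedding G_order uv nuv eE.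
    have := rhoD_lt R G_gt1 hI _ hadj niso.
    by rewrite G_order card_ord ltNge le_rho => /(_ erefl).
  have cod0 : \sum_(u : G) codeg u = 0.
    apply: big1 => u _; apply: eq_card0 => v; rewrite inE.
    by apply: contraNF complete => uv; apply/existsP; exists u; apply/existsP; exists v.
  apply: tau_ge_codeg => //.
    by apply: two_comp_le => //; rewrite cod0 G_order; nia.
  by move=> t; rewrite cod0 G_order nE => /andP[t_gt1 tn]; nia.
- have [big|small] := leqP (2 * k + 2) (\sum_(u : G) codeg u).
    have := @path_matching_radius_lt R G k k_ge2 _ big niso.
    by rewrite ltNge le_rho G_order => /(_ nE).
  have cE := card_edges G; rewrite G_order nE in cE.
  (* Parity of the sum excludes [2 k + 1]. *)
  have {}small : \sum_(u : G) codeg u <= 2 * k.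
    by move: cE small; move: (\sum_u _) => s; nia.
  apply: tau_ge_codeg => //.
    by apply: two_comp_le => //; rewrite G_order nE; nia.
  by move=> t; rewrite G_order nE => /andP[t_gt1 tn]; nia.
have [/existsP[x dx]|mindeg] := boolP [exists x : G, deg x <= k - 1].
  have GE : #|G| = k - 1 + (n - k).+1 by lia.
  have [h hI hadj] := kite_embedding GE dx.
  have := rhoD_lt R G_gt1 hI _ hadj niso.
  by rewrite ltNge le_rho card_kite => /(_ GE).
have {}mindeg (x : G) : k <= deg x.
  by rewrite negb_exists in mindeg; have := forallP mindeg x; lia.
have [big|small] := leqP (4 * (n - k) - 4) (\sum_(u : G) codeg u).
  by have := kite_radius_lt R k_ge2 n_ge G_order big; rewrite ltNge le_rho.
have cE := card_edges G; rewrite G_order in cE.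
(* Parity again improves the bound by one. *)
have {}small : \sum_(u : G) codeg u <= 4 * (n - k) - 6.
  have : ~~ odd (n * n.-1) by case: (n) => // m; rewrite oddM /=; case: odd.
  by rewrite -cE oddD oddM /= => so; move: small so; lia.
apply: tau_ge_codeg => //.
  by apply: (two_comp_mindeg _ mindeg) => //; rewrite G_order; nia.
move=> t; rewrite G_order => /andP[t_gt1 tn].
(* Writing [t = j + 2] and [n = j + r + 3] removes truncated subtraction; [kj] is [2 k <= n - 2]
   multiplied by [j], so that the product of [k] and [j] can be treated as an atom. *)
have [j tE] : exists j, t = j + 2 by exists (t - 2); lia.
have [r nE] : exists r, n = j + r + 3 by exists (n - t - 1); lia.
have kj : 2 * k * j <= (j + r + 1) * j by rewrite leq_mul2r; apply/orP; right; lia.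
have -> : n - t = r.+1 by lia.
have -> : n * n.-1 = (j + r + 3) * (j + r + 2) by rewrite nE; congr (_ * _); lia.
have -> : 2 * (k * t) = 2 * k * j + 4 * k by rewrite tE; lia.
have {}small : \sum_(u : G) codeg u + 4 * k <= 4 * (j + r) + 6 by lia.
by move: small kj => /=; move: (\sum_u _) (2 * k * j) => s p; nia.
Qed.
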